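(* Let $q\in(0,1)$ be fixed. Let $f(x)=\sum_{k=0}^\infty a_k\phi_k(x;1)$ be a transcendental entire function of log-order $\sigma_{\log}<2$, let $\gamma\in\left(1,\frac{1}{\sigma_{\log}-1}\right)$, and let $\delta\in(0,1)$. Then there exists a set $E\subset[1,\infty)$ of zero logarithmic density such that for every $h\ge 0$, $\beta>0$ and $\omega\in(0,\beta)$, we have $$\sum_{k:\,|k-N|\ge \kappa} q^{-hk}[k]_q^h\,|a_k\phi_k(-r;1)| = o\!\left(\mu_q(r;f)\,q^{-hN}[N]_q^h\, b(N)^{\frac{\omega-1}{2}}\right)$$ as $r\to\infty$ and $r\in(0,\infty)\setminus E$, where $N=\nu_q(r;f)$, $b(N):=N^{-1+\delta}$ and $\kappa=\left[\sqrt{\frac{\beta}{b(N)}\ln\frac{1}{b(N)}}\right]$.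
   Context: $\mathbb{N}_0=\{0,1,2,\ldots\}$; $[k]_q:=\frac{1-q^k}{1-q}$; in the definition of $\kappa$, $[\cdot]$ denotes the integer part. Sums run over indices $k\in\mathbb{N}_0$. For an entire function $f$, $M(r;f):=\max\{|f(x)|:|x|=r\}$, and its log-order is $\sigma_{\log}=\sigma_{\log}(f):=\limsup_{r\to\infty}\frac{\ln^+\ln^+ M(r;f)}{\ln\ln r}$, where $\ln^+ t:=\max\{\ln t,0\}$. A non-constant entire function has log-order at least $1$; when $\sigma_{\log}=1$, $\frac1{\sigma_{\log}-1}$ is read as $+\infty$. The Askey-Wilson basis at $1$ is $\phi_0(x;1):=1$ and $\phi_k(x;1):=\prod_{j=0}^{k-1}(1-2xq^j+q^{2j})=(-2)^kq^{\frac{k(k-1)}2}\prod_{j=0}^{k-1}\left(x-\frac{q^j+q^{-j}}2\right)$ for $k\ge1$. Every entire function $f$ of log-order smaller than $2$ has a unique expansion $f(x)=\sum_{k=0}^\infty a_k\phi_k(x;1)$ converging uniformly on compact subsets of $\mathbb{C}$ (its Askey-Wilson series expansion). For such $f\not\equiv0$ and $r>0$, the Askey-Wilson maximal term is $$\mu_q(r;f):=\max_{n\in\mathbb{N}_0}\max_{|x|=r}|a_n\phi_n(x;1)|=\max_{n\in\mathbb{N}_0}|a_n|2^nq^{\frac{n(n-1)}2}\prod_{k=0}^{n-1}\left(r+\frac{q^k+q^{-k}}2\right),$$ and the Askey-Wilson central index $\nu_q(r;f)$ is the largest $n\in\mathbb{N}_0$ for which $|a_n|2^nq^{\frac{n(n-1)}2}\prod_{k=0}^{n-1}\left(r+\frac{q^k+q^{-k}}2\right)=\mu_q(r;f)$.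 The logarithmic density of $E\subseteq[1,\infty)$ is $\limsup_{r\to\infty}\frac1{\ln r}\int_{E\cap[1,r]}\frac{dx}{x}$ (Lebesgue measure). ''$g(r)=o(F(r))$ as $r\to\infty$ and $r\in(0,\infty)\setminus E$'' means: for every $C>0$ there is $R>0$ such that $|g(r)|\le C|F(r)|$ for all $r>R$ with $r\notin E$. *)

(* Defs.v *)
From HB Require Import structures.
From mathcomp Require Import all_boot all_order all_algebra.
From mathcomp Require Import all_classical all_reals all_analysis.
From mathcomp.real_closed Require Export complex.

Set Implicit Arguments.
Unset Strict Implicit.
Unset Printing Implicit Defensive.

Import Order.TTheory GRing.Theory Num.Theory.
Import numFieldNormedType.Exports.

Local Open Scope classical_set_scope.
Local Open Scope ring_scope.
Local Open Scope complex_scope.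

(* The analytic structure of the complex numbers is carried by the regular
   algebra (R[i])^o: R[i] itself has no topology in the libraries. *)
Definition entire (R : realType) (f : R[i] -> R[i]) : Prop :=
  forall z : (R[i])^o, derivable (f : (R[i])^o -> (R[i])^o) z 1.

Definition transcendental_entire (R : realType) (f : R[i] -> R[i]) : Prop :=
  entire f /\ ~ exists p : {poly R[i]}, forall z, f z = p.[z].

(* The modulus as an element of R: the norm `|z| of R[i] lives in R[i]. *)
Definition cmod (R : realType) (z : R[i]) : R := ComplexField.Normc.normc z.

Definition max_modulus (R : realType) (r : R) (f : R[i] -> R[i]) : R :=
  sup [set cmod (f x) | x in [set x | cmod x = r]].

Definition lnp (R : realType) (t : R) : R := Num.max (ln t) 0.

Definition log_order (R : realType) (f : R[i] -> R[i]) : \bar R :=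
  limf_esup (fun r : R => (lnp (lnp (max_modulus r f)) / ln (ln r))%:E) +oo.

Definition qnum (R : realType) (q : R) (k : nat) : R :=
  (1 - q ^+ k) / (1 - q).

Definition aw_phi (R : realType) (q : R) (k : nat) (x : R[i]) : R[i] :=
  \prod_(j < k) (1 - 2 * x * (q ^+ j)%:C + (q ^+ (2 * j))%:C).

Definition aw_expansion (R : realType) (q : R) (a : nat -> R[i])
    (f : R[i] -> R[i]) : Prop :=
  {family compact, (fun (n : nat) (x : (R[i])^o) =>
     (\sum_(k < n) a k * aw_phi q k x) : (R[i])^o) @ \oo
   --> (f : (R[i])^o -> (R[i])^o)}.

(* The suprema are maxima as soon as r > 0 and a is the coefficient sequence
   of an Askey-Wilson series that converges at -r. *)
Definition aw_max_term (R : realType) (q : R) (a : nat -> R[i]) (r : R) : R :=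
  sup [set max_modulus r (fun x => a n * aw_phi q n x) | n in [set: nat]].

Definition aw_term (R : realType) (q : R) (a : nat -> R[i]) (r : R)
    (n : nat) : R :=
  cmod (a n) * 2 ^+ n * q ^+ (n * n.-1)./2
    * \prod_(k < n) (r + (q ^+ k + q ^- k) / 2).

(* The default value 0 is used only when there is no largest such n, which
   does not happen for the nonzero functions of log-order less than 2. *)
Definition aw_central_index (R : realType) (q : R) (a : nat -> R[i]) (r : R)
    : nat :=
  xget 0%N [set n : nat | aw_term q a r n = aw_max_term q a r /\
    forall m : nat, aw_term q a r m = aw_max_term q a r -> (m <= n)%N].

Definition log_density (R : realType) (E : set R) : \bar R :=
  limf_esup (fun r : R => ((ln r)^-1)%:E *
    \int[lebesgue_measure]_(x in E `&` `[1%R, r]) (x^-1)%:E)%E +oo.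

(* g = o(F) as r -> +oo outside E; g is extended-real valued because it is the
   sum of a series of nonnegative terms, so that the bound contains the
   convergence of that series. *)
Definition little_o_outside (R : realType) (E : set R) (g : R -> \bar R)
    (F : R -> R) : Prop :=
  forall C : R, 0 < C -> exists2 R0 : R, 0 < R0 &
    forall r : R, R0 < r -> ~ E r -> (`|g r| <= (C * `|F r|)%:E)%E.

Definition wv_b (R : realType) (delta : R) (N : nat) : R :=
  N%:R `^ (- 1 + delta).

Definition wv_kappa (R : realType) (delta beta : R) (N : nat) : int :=
  Num.floor (Num.sqrt (beta / wv_b delta N * ln (1 / wv_b delta N))).

Definition aw_tail_sum (R : realType) (q : R) (a : nat -> R[i]) (h : R)
    (r : R) (N : nat) (kappa : int) : \bar R :=
  (\sum_(k <oo | (kappa <= `|k%:Z - N%:Z|)%R)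
     (q `^ (- (h * k%:R)) * qnum q k `^ h
        * cmod (a k * aw_phi q k (- r%:C)))%:E)%E.

(* Main.v *)
Require Import Defs.
From HB Require Import structures.
From mathcomp Require Import all_boot all_order all_algebra.
From mathcomp Require Import all_classical all_reals all_analysis.
From mathcomp Require Import measurable_realfun.
From mathcomp Require Import all_field.
From mathcomp Require Import zify ring lra.

Import Order.TTheory GRing.Theory Num.Theory.
Import numFieldNormedType.Exports.

Local Open Scope classical_set_scope.
Local Open Scope ring_scope.
Local Open Scope complex_scope.

(** Write t_n(r) for |a_n phi_n(-r;1)|, which is the maximum of the n-th term on
    the circle |x| = r, and N(r) for the central index. Difficulties arise only
    near the radii where N jumps, and the growth hypothesis makes jumps so rare
    that generous neighbourhoods of them can be discarded.

    Growth. With s = 1 / gamma < 1, the log-order bound says that f is at most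
    exp((ln r)^(1+s)) on large circles. A Cauchy estimate turns this into a
    bound for the coefficients: an Askey-Wilson sum can be stripped of the
    factors of its basis one by one, each step reading off a coefficient at the
    zero of the next factor and gaining the radius of the circle
    (aw_nest_coef_le, aw_term_circle_le). This requires a maximum principle for
    polynomials only, and a weak one suffices (poly_half_disc_le). Optimizing
    the radius yields, for any p between s and 1, that t_n(r) <= r^(-n) whenever
    n >= (ln r)^p and r is large (aw_term_decay). In particular N(r) < (ln r)^p.

    Exceptional set. On the scale of m = [ln r] the nondecreasing function N has
    at most M^p jumps up to M, so the windows of half-width v = [m^((1-p)/2)]
    around m that contain a jump have density zero (jump_count_sublinear). The
    set of all r with such an m is a union of intervals [e^m, e^(m+1)), and has
    zero logarithmic density (log_density_jump_set). It depends on neither h,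
    beta nor omega.

    Domination. For r outside this set N is constant on [r e^(-v), r e^v], with
    v tending to infinity. As long as r q^j is large, each factor of the basis
    is nearly proportional to r, so comparing t_k with t_N at r and at the ends
    of this interval, where t_N is still maximal, gives
    t_k(r) <= (2 e^(-v))^|k-N| t_N(r). This covers all k below (ln r)^p because
    p < 1, and the absolute decay covers the others. Hence
    t_k <= theta^|k-N| t_N for every fixed theta in (0, 1) and all large r
    (aw_term_geometric). The choice theta = q^h / 4 absorbs the weights and
    leaves a tail of order 2^(-kappa) times the maximal term; since kappa grows
    like a power of N, this is smaller than any power of b(N) (kappa_small). *)

Set Implicit Arguments.
Unset Strict Implicit.

(** * Polynomials on a circle of the complex plane *)

Lemma dvdn_shift_eq (m i j : nat) :
  (j < m)%N -> (i < m)%N -> (m %| i + (m - j))%N -> i = j.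
Proof.
move=> jm im /dvdnP[c Hc]; have c1 : c = 1%N by nia.
by move: Hc; rewrite c1 mul1n; lia.
Qed.

Lemma eq_ler (R : numDomainType) (x y : R) : x = y -> x <= y.
Proof. by move=> ->. Qed.

Section Modulus.
Variable R : realType.
Implicit Types (x y z : R[i]) (r : R).

Lemma cmodM x y : cmod (x * y) = cmod x * cmod y.
Proof. exact: ComplexField.Normc.normcM. Qed.

Lemma cmodD x y : cmod (x + y) <= cmod x + cmod y.
Proof. exact: le_normcD. Qed.

Lemma cmodN x : cmod (- x) = cmod x.
Proof. exact: normcN. Qed.

Lemma cmodB x y : cmod (x - y) <= cmod x + cmod y.
Proof. by rewrite -(cmodN y) cmodD. Qed.

Lemma cmod_ge0 x : 0 <= cmod x.
Proof. by case: x => a b; exact: sqrtr_ge0. Qed.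

Lemma cmod0 : cmod (0 : R[i]) = 0.
Proof. exact: ComplexField.Normc.normc0. Qed.

Lemma cmod1 : cmod (1 : R[i]) = 1.
Proof. exact: ComplexField.Normc.normc1. Qed.

Lemma cmod_eq0 x : (cmod x == 0) = (x == 0).
Proof.
apply/eqP/eqP => [/ComplexField.Normc.eq0_normc //|->]; exact: cmod0.
Qed.

Lemma cmodX x n : cmod (x ^+ n) = cmod x ^+ n.
Proof. by elim: n => [|n IH]; rewrite ?expr0 ?cmod1 // !exprS cmodM IH. Qed.

Lemma cmod_prod n (F : 'I_n -> R[i]) :
  cmod (\prod_(j < n) F j) = \prod_(j < n) cmod (F j).
Proof.
elim: n F => [|n IH] F; first by rewrite !big_ord0 cmod1.
by rewrite !big_ord_recr /= cmodM IH.
Qed.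

Lemma cmod_sum n (F : 'I_n -> R[i]) :
  cmod (\sum_(j < n) F j) <= \sum_(j < n) cmod (F j).
Proof.
elim: n F => [|n IH] F; first by rewrite !big_ord0 cmod0.
by rewrite !big_ord_recr /= (le_trans (cmodD _ _)) // lerD2r IH.
Qed.

Lemma cmod_real r : cmod r%:C = `|r|.
Proof. by rewrite /cmod /= expr0n /= addr0 sqrtr_sqr. Qed.

Lemma cmod_nat n : cmod (n%:R : R[i]) = n%:R.
Proof. by rewrite -(rmorph_nat (real_complex R)) cmod_real normr_nat. Qed.

Lemma normc_cmod z : `|z| = (cmod z)%:C.
Proof. by case: z => a b; rewrite normc_def. Qed.

Lemma complex_primitive_root m : (0 < m)%N ->
  {w : R[i] | m.-primitive_root w}.
Proof.
move=> m_gt0; pose p : {poly R[i]} := 'X^m - 1.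
have [rs Dp] := closed_field_poly_normal p.
apply/sigW; rewrite (monicP _) ?monicXnsubC // scale1r in Dp.
have rn1 : all m.-unity_root rs.
  by apply/allP=> z; rewrite -root_prod_XsubC -Dp.
have sz_r : (m < (size rs).+1)%N.
  by rewrite -(size_prod_XsubC rs id) -Dp size_XnsubC.
have [|z] := hasP (cyclic.has_prim_root m_gt0 rn1 _ sz_r); last by exists z.
by rewrite -separable_prod_XsubC -Dp separable_Xn_sub_1 // pnatr_eq0 -lt0n.
Qed.

Lemma sum_primitive_root_powers m (w : R[i]) i : (0 < m)%N ->
  m.-primitive_root w ->
  \sum_(k < m) w ^+ (k * i) = if (m %| i)%N then m%:R else 0.
Proof.
move=> m_gt0 prim_w; under eq_bigr do rewrite mulnC exprM.
have wim : (w ^+ i) ^+ m = 1.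
  by rewrite exprAC (prim_expr_order prim_w) expr1n.
rewrite (prim_order_dvd prim_w); have [->|wi1] := eqVneq (w ^+ i) 1.
  by under eq_bigr do rewrite expr1n; rewrite sumr_const card_ord.
have /eqP := subrX1 (w ^+ i) m; rewrite wim subrr eq_sym mulf_eq0 subr_eq0.
by rewrite (negPf wi1) /= => /eqP.
Qed.

(** Cauchy's estimate for a coefficient. Averaging p(x) x^(-j) over the m-th
    roots of unity scaled to the circle, with m above the degree, isolates the
    j-th coefficient exactly, so a finite average replaces the contour
    integral. *)
Lemma poly_coef_circle_le (p : {poly R[i]}) (rho M : R) j : 0 < rho ->
  (forall x, cmod x = rho -> cmod p.[x] <= M) ->
  cmod p`_j * rho ^+ j <= M.
Proof.
move=> rho0 pM; have M0 : 0 <= M.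
  by rewrite (le_trans _ (pM rho%:C _)) ?cmod_ge0 // cmod_real gtr0_norm.
have [szp|jsz] := leqP (size p) j.
  by rewrite nth_default // cmod0 mul0r.
set m := size p; have m_gt0 : (0 < m)%N by apply: leq_ltn_trans jsz.
have [w prim_w] := complex_primitive_root m_gt0.
have modw k : cmod (w ^+ k) = 1.
  rewrite cmodX; suff -> : cmod w = 1 by rewrite expr1n.
  apply/eqP; rewrite -(@pexpr_eq1 _ _ m) ?cmod_ge0 // -cmodX.
  by rewrite (prim_expr_order prim_w) cmod1.
(* The exponent m - j stands for -j, as the m-th power of w is 1. *)
have avg : \sum_(k < m) p.[rho%:C * w ^+ k] * w ^+ (k * (m - j))
    = m%:R * (p`_j * rho%:C ^+ j).
  under eq_bigr do rewrite horner_coef big_distrl /=.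
  rewrite exchange_big /= (bigD1 (Ordinal jsz)) //= [X in _ + X]big1 ?addr0.
    rewrite (eq_bigr (fun k : 'I_m => p`_j * rho%:C ^+ j)) => [|k _].
      by rewrite sumr_const card_ord mulr_natl.
    rewrite exprMn -exprM -!mulrA -exprD -mulnDr subnKC 1?ltnW //.
    by rewrite mulnC exprM (prim_expr_order prim_w) expr1n mulr1.
  move=> i /negP ij.
  rewrite (eq_bigr (fun k : 'I_m =>
      p`_i * rho%:C ^+ i * w ^+ (k * (i + (m - j))))) => [|k _].
    rewrite -big_distrr /= sum_primitive_root_powers //.
    case: ifP => [Hc|]; last by rewrite mulr0.
    case: ij; apply/eqP/val_inj => /=.
    by apply: dvdn_shift_eq jsz (ltn_ord i) _; exact: Hc.
  by rewrite exprMn -exprM -!mulrA -exprD -mulnDr.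
have : cmod (m%:R * (p`_j * rho%:C ^+ j)) <= m%:R * M.
  rewrite -avg (le_trans (cmod_sum _)) //.
  apply: (@le_trans _ _ (\sum_(k < m) M)); last first.
    by rewrite sumr_const card_ord mulr_natl.
  apply: ler_sum => k _; rewrite cmodM modw mulr1; apply: pM.
  by rewrite cmodM modw mulr1 cmod_real gtr0_norm.
rewrite !cmodM cmodX cmod_real gtr0_norm // cmod_nat ler_pM2l //.
by rewrite ltr0n.
Qed.

(** A weak maximum principle: summing Cauchy's estimates gives a geometric
    series of ratio 1/2, whence the factor 2 instead of the sharp 1. *)
Lemma poly_half_disc_le (p : {poly R[i]}) (rho M : R) z : 0 < rho ->
  (forall x, cmod x = rho -> cmod p.[x] <= M) ->
  cmod z <= rho / 2 -> cmod p.[z] <= 2 * M.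
Proof.
move=> rho0 pM zr; have M0 : 0 <= M.
  by rewrite (le_trans _ (pM rho%:C _)) ?cmod_ge0 // cmod_real gtr0_norm.
rewrite horner_coef (le_trans (cmod_sum _)) //.
have geo n : \sum_(i < n) (2^-1 : R) ^+ i <= 2 - 2 * 2^-1 ^+ n.
  elim: n => [|n IH]; first by rewrite big_ord0 expr0; lra.
  rewrite big_ord_recr /= exprS; have : 0 <= 2^-1 ^+ n :> R by apply: exprn_ge0.
  by move: IH => /=; set y := _ ^+ n; move: y => y; lra.
apply: (@le_trans _ _ (\sum_(i < size p) M * 2^-1 ^+ i)).
  apply: ler_sum => i _; rewrite cmodM cmodX.
  have h2 : 0 <= 2^-1 ^+ i :> R by rewrite exprn_ge0.
  apply: (le_trans _ (ler_wpM2r h2 (poly_coef_circle_le i rho0 pM))).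
  rewrite -mulrA -exprMn ler_wpM2l ?cmod_ge0 //.
  by rewrite lerXn2r ?nnegrE ?cmod_ge0 // mulr_ge0 // ltW.
rewrite -big_distrr /= mulrC ler_wpM2r //.
by rewrite (le_trans (geo _)) // gerBl mulr_ge0 // exprn_ge0.
Qed.

End Modulus.

(** * Cauchy estimates for Askey-Wilson coefficients *)

Section AskeyWilsonBasis.
Variables (R : realType) (q : R).
Hypotheses (q_gt0 : 0 < q) (q_lt1 : q < 1).
Implicit Types (a : nat -> R[i]) (r rho B : R) (x : R[i]).

(** The modulus of the j-th factor of the Askey-Wilson basis at -r, which is its
    maximum over the circle of radius r. *)
Definition aw_factor j r : R := 1 + 2 * r * q ^+ j + q ^+ (2 * j).

Definition aw_radial n r : R := \prod_(j < n) aw_factor j r.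

Lemma qX_gt0 j : 0 < q ^+ j. Proof. exact: exprn_gt0. Qed.

Lemma qX_le1 j : q ^+ j <= 1. Proof. by rewrite exprn_ile1 // ltW. Qed.

Lemma aw_factor_gt0 j r : 0 <= r -> 0 < aw_factor j r.
Proof.
move=> r0; rewrite /aw_factor addr_gt0 ?qX_gt0 // ltr_wpDr //.
by rewrite !mulr_ge0 // (ltW (qX_gt0 _)).
Qed.

Lemma aw_radial_gt0 n r : 0 <= r -> 0 < aw_radial n r.
Proof. by move=> r0; apply: prodr_gt0 => j _; exact: aw_factor_gt0. Qed.

Lemma aw_factor_le j r : aw_factor j r <= 2 + 2 * r * q ^+ j.
Proof. by rewrite /aw_factor; have := qX_le1 (2 * j); lra. Qed.

Lemma le_aw_factor j r1 r2 : r1 <= r2 -> aw_factor j r1 <= aw_factor j r2.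
Proof.
by move=> r12; rewrite lerD2r lerD2l ler_wpM2r ?ler_wpM2l // (ltW (qX_gt0 _)).
Qed.

Lemma le_aw_radial n r1 r2 : 0 <= r1 -> r1 <= r2 ->
  aw_radial n r1 <= aw_radial n r2.
Proof.
move=> r0 r12; apply: ler_prod => j _.
by rewrite ltW ?aw_factor_gt0 //= le_aw_factor.
Qed.

Lemma aw_radialS n r : aw_radial n.+1 r = aw_radial n r * aw_factor n r.
Proof. by rewrite /aw_radial big_ord_recr. Qed.

Lemma half_mulnpredS n : ((n.+1 * n)./2 = n + (n * n.-1)./2)%N.
Proof.
have -> : (n.+1 * n = n.*2 + n * n.-1)%N by case: n => // n /=; lia.
by rewrite halfD odd_double /= doubleK.
Qed.

Lemma aw_termE a r n : aw_term q a r n = cmod (a n) * aw_radial n r.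
Proof.
rewrite /aw_term -!mulrA; congr (_ * _).
elim: n => [|n IH]; first by rewrite /aw_radial !big_ord0 !expr0 !mulr1.
rewrite aw_radialS -IH big_ord_recr /= half_mulnpredS exprD exprS.
rewrite /aw_factor [(2 * n)%N]mulnC exprM.
have qn0 : q ^+ n != 0 by rewrite gt_eqF ?qX_gt0.
set u := q ^+ n in qn0 *; set v := q ^+ _; set w := \prod_(k < n) _.
set z := 2 ^+ n.
have -> : r + (u + u^-1) / 2 = (2 * u)^-1 * (1 + 2 * r * u + u ^+ 2).
  by field.
by field.
Qed.

Lemma cmod_aw_factor_le j r x : cmod x <= r ->
  cmod (1 - 2 * x * (q ^+ j)%:C + (q ^+ (2 * j))%:C) <= aw_factor j r.
Proof.
move=> xr; apply: le_trans (cmodD _ _) _; rewrite cmod_real.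
rewrite ger0_norm ?(ltW (qX_gt0 _)) // /aw_factor lerD2r.
apply: le_trans (cmodB _ _) _; rewrite cmod1 lerD2l !cmodM cmod_nat cmod_real.
rewrite ger0_norm ?(ltW (qX_gt0 _)) // ler_wpM2r ?ler_wpM2l //.
by rewrite (ltW (qX_gt0 _)).
Qed.

Lemma cmod_aw_phi_le n r x : cmod x <= r ->
  cmod (aw_phi q n x) <= aw_radial n r.
Proof.
move=> xr; rewrite cmod_prod; apply: ler_prod => j _.
by rewrite cmod_ge0 cmod_aw_factor_le.
Qed.

Lemma cmod_aw_phi_neg n r : 0 <= r ->
  cmod (aw_phi q n (- r%:C)) = aw_radial n r.
Proof.
move=> r0; rewrite cmod_prod; apply: eq_bigr => j _.
rewrite -[RHS]ger0_norm ?ltW ?aw_factor_gt0 // -cmod_real; congr cmod.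
rewrite /aw_factor !rmorphD !rmorphM rmorph1 /= rmorph_nat.
by rewrite mulrN mulNr opprK.
Qed.

(** The Horner-like nesting of an Askey-Wilson sum: stripping one factor of the
    basis after the other turns each coefficient into the value of a polynomial
    at a zero of the next factor. *)
Fixpoint aw_nest a (m j : nat) : {poly R[i]} :=
  if m is m'.+1 then
    (a j)%:P + ((1 + (q ^+ (2 * j))%:C)%:P - (2 * (q ^+ j)%:C) *: 'X)
                 * aw_nest a m' j.+1
  else 0.

Lemma aw_nestE a m j x : (aw_nest a m.+1 j).[x] =
  a j + (1 - 2 * x * (q ^+ j)%:C + (q ^+ (2 * j))%:C) * (aw_nest a m j.+1).[x].
Proof. by rewrite /= !hornerE; congr (_ + _ * _); ring. Qed.

Lemma aw_nest_phi a m j x : aw_phi q j x * (aw_nest a m j).[x] =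
  \sum_(k < m) a (j + k)%N * aw_phi q (j + k) x.
Proof.
elim: m j => [|m IH] j; first by rewrite big_ord0 horner0 mulr0.
rewrite aw_nestE big_ord_recl addn0 mulrDr mulrA [_ * a j]mulrC.
congr (_ + _); rewrite -[X in X * _]/(_ * _).
have -> : aw_phi q j x * (1 - 2 * x * (q ^+ j)%:C + (q ^+ (2 * j))%:C)
    = aw_phi q j.+1 x by rewrite /aw_phi big_ord_recr.
by rewrite IH; apply: eq_bigr => k _; rewrite /= /bump addSnnS.
Qed.

Lemma aw_nest_sum a m x :
  (aw_nest a m 0).[x] = \sum_(k < m) a k * aw_phi q k x.
Proof. by rewrite -(aw_nest_phi a m 0) /aw_phi big_ord0 mul1r. Qed.

(** One stripping step multiplies the bound on the circle by 3 / (rho q^j): the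
    coefficient a j is a value in the half disc, hence at most 2 B, so that the
    difference is at most 3 B; and the factor divided out has modulus at least
    rho q^j on the circle, whose radius is at least twice its zero. *)
Lemma aw_nest_coef_le a rho i : forall m j B, (i < m)%N ->
  (forall x, cmod x = rho -> cmod (aw_nest a m j).[x] <= B) ->
  2 <= rho * q ^+ (j + i) ->
  cmod (a (j + i)%N) * \prod_(k < i) (q ^+ (j + k) * rho / 3) <= 2 * B.
Proof.
have coef0 m j B : (0 < m)%N ->
  (forall x, cmod x = rho -> cmod (aw_nest a m j).[x] <= B) ->
  2 <= rho * q ^+ j -> cmod (a j) <= 2 * B.
  case: m => // m _ gB rhoj; have qj := qX_gt0 j; have qj1 := qX_le1 j.
  have rho0 : 0 < rho by nra.
  (* The zero of the factor stripped off next: there the value is a j. *)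
  pose node := ((q ^+ j + (q ^+ j)^-1) / 2)%:C.
  have <- : (aw_nest a m.+1 j).[node] = a j.
    rewrite aw_nestE.
    suff -> : 1 - 2 * node * (q ^+ j)%:C + (q ^+ (2 * j))%:C = 0.
      by rewrite mul0r addr0.
    have -> : (2 : R[i]) = (2 : R)%:C by rewrite rmorph_nat.
    rewrite -!rmorphM -[1]/(1%:C) -rmorphB -rmorphD /= mulnC exprM.
    by rewrite -[0]/(0%:C); congr (_%:C); field; rewrite gt_eqF.
  apply: poly_half_disc_le rho0 gB _.
  have qV0 : 0 < (q ^+ j)^-1 by rewrite invr_gt0.
  rewrite cmod_real ger0_norm; last by rewrite divr_ge0 // addr_ge0 // ltW.
  rewrite ler_pM2r // -(ler_pM2r qj) mulrDl mulVf ?gt_eqF //; nra.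
elim: i => [|i IH] m j B im gB rhoj.
  by rewrite addn0 big_ord0 mulr1 in rhoj *; exact: coef0 gB rhoj.
case: m im gB => // m im gB.
have qj := qX_gt0 j; have qj1 := qX_le1 j; have qji := qX_le1 i.+1.
have qi0 := qX_gt0 i.+1.
have rho0 : 0 < rho.
  by rewrite -(pmulr_lgt0 _ (qX_gt0 (j + i.+1))); lra.
have rhoj1 : 2 <= rho * q ^+ j.
  apply: le_trans rhoj _; rewrite exprD ler_wpM2l ?(ltW rho0) //; nra.
have aj : cmod (a j) <= 2 * B by apply: (coef0 m.+1).
have gB' x : cmod x = rho ->
    cmod (aw_nest a m j.+1).[x] <= 3 * B / (q ^+ j * rho).
  move=> xrho; rewrite ler_pdivlMr ?mulr_gt0 // mulrC.
  set F := 1 - 2 * x * (q ^+ j)%:C + (q ^+ (2 * j))%:C.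
  have Fge : q ^+ j * rho <= cmod F.
    have : cmod (2 * x * (q ^+ j)%:C) <= cmod (1 + (q ^+ (2 * j))%:C) + cmod F.
      have -> : 2 * x * (q ^+ j)%:C = (1 + (q ^+ (2 * j))%:C) - F.
        by rewrite /F; ring.
      exact: cmodB.
    have := cmodD 1 (q ^+ (2 * j))%:C.
    rewrite !cmodM cmod_nat !cmod_real ?cmod1 ?normr1 xrho.
    rewrite !ger0_norm ?(ltW (qX_gt0 _)) //.
    by have := qX_le1 (2 * j); lra.
  apply: le_trans (ler_wpM2r (cmod_ge0 _) Fge) _; rewrite -cmodM.
  have -> : F * (aw_nest a m j.+1).[x] = (aw_nest a m.+1 j).[x] - a j.
    by rewrite aw_nestE /F; ring.
  by apply: le_trans (cmodB _ _) _; have := gB x xrho; lra.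
have := IH m j.+1 _ im gB'; rewrite addSnnS => /(_ rhoj).
rewrite big_ord_recl addn0 /= => le1.
have -> : \prod_(k < i) (q ^+ (j + lift ord0 k) * rho / 3) =
    \prod_(k < i) (q ^+ (j.+1 + k) * rho / 3).
  by apply: eq_bigr => k _; rewrite /= /bump addSnnS.
move: le1; move: (\prod_(k < i) _) (cmod _) => p c le1.
have := ler_wpM2r (ltW (mulr_gt0 qj rho0)) le1.
have -> : 2 * (3 * B / (q ^+ j * rho)) * (q ^+ j * rho) = 6 * B.
  by field; rewrite !gt_eqF.
by move: (q ^+ j * rho) => u; nra.
Qed.

(** Cauchy's estimate for an Askey-Wilson series. The products of the q^k in the
    bound on the coefficient and in the basis polynomial cancel, which leaves a
    gain of rho^(-n) on a circle much larger than r and the first n nodes. *)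
Lemma aw_term_circle_le a rho B m n r : (n < m)%N -> 0 <= r ->
  (forall x, cmod x = rho -> cmod (\sum_(k < m) a k * aw_phi q k x) <= B) ->
  2 <= rho * q ^+ n ->
  aw_term q a r n <= 2 * B * (6 * (r + q ^- n) / rho) ^+ n.
Proof.
move=> nm r0 sB rhon.
have rho0 : 0 < rho by rewrite -(pmulr_lgt0 _ (qX_gt0 n)); lra.
have gB x : cmod x = rho -> cmod (aw_nest a m 0).[x] <= B.
  by move=> /sB; rewrite aw_nest_sum.
have le1 := aw_nest_coef_le nm gB rhon.
rewrite aw_termE; set X := 6 * _ / _.
have X0 : 0 <= X.
  by rewrite /X divr_ge0 ?ltW // mulr_gt0 // ltr_wpDl // invr_gt0 qX_gt0.
apply: le_trans (ler_wpM2r (exprn_ge0 n X0) le1).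
rewrite -mulrA ler_wpM2l ?cmod_ge0 //.
have -> : X ^+ n = \prod_(k < n) X by rewrite prodr_const card_ord.
rewrite -big_split /=; apply: ler_prod => k _; rewrite add0n.
rewrite ltW ?aw_factor_gt0 //=; apply: le_trans (aw_factor_le _ _) _.
have qk := qX_gt0 k; have qn := qX_gt0 n.
have kn : 1 <= q ^+ k * q ^- n.
  rewrite ler_pdivlMr // mul1r.
  by rewrite ler_wiXn2l ?(ltW q_gt0) ?(ltW q_lt1) // ltnW.
have -> : q ^+ k * rho / 3 * X = 2 * r * q ^+ k + 2 * (q ^+ k * q ^- n).
  by rewrite /X; field; rewrite !gt_eqF.
by lra.
Qed.

End AskeyWilsonBasis.

(** * Uniform convergence on circles *)

Section UniformConvergence.
Variable R : realType.

Lemma lt_normc_real (z : R[i]) (e : R) : (`|z| < e%:C) = (cmod z < e).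
Proof. by rewrite normc_cmod ltcR. Qed.

Lemma continuous_real_complex :
  continuous (fun x : R => (x%:C : (R[i])^o)).
Proof.
move=> x; apply/cvgrPdist_lt => e e0.
have [e' ee'] : exists e' : R, e = e'%:C by apply/complex_realP/gtr0_real.
move: e0; rewrite ee' ltcR => e0.
have : \forall t \near x, `|x - t| < e'.
  exact: (nbhsx_ballx x e' e0).
apply: filterS => t /= xt.
by rewrite -rmorphB lt_normc_real cmod_real.
Qed.

(** A compact set that contains the circle of radius rho. *)
Definition complex_square (rho : R) : set ((R[i])^o) :=
  (fun p : R * R => p.1%:C + 'i * p.2%:C : (R[i])^o) @`
    (`[- rho, rho] `*` `[- rho, rho]).

Lemma compact_complex_square (rho : R) : compact (complex_square rho).
Proof.
apply: continuous_compact; last by apply: compact_setX; exact: segment_compact.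
apply: continuous_subspaceT => p; apply: cvgD.
  apply: (@continuous_comp _ _ _ fst (fun x : R => (x%:C : (R[i])^o))).
    exact: cvg_fst.
  exact: continuous_real_complex.
apply: (@cvgMr _ _ _ _ (fun p : R * R => (p.2%:C : (R[i])^o))).
apply: (@continuous_comp _ _ _ snd (fun x : R => (x%:C : (R[i])^o))).
  exact: cvg_snd.
exact: continuous_real_complex.
Qed.

Lemma circle_sub_square (rho : R) (x : R[i]) :
  cmod x = rho -> complex_square rho x.
Proof.
case: x => u v <-; rewrite /complex_square /=.
have le_cmod : `|u| <= cmod (u +i* v) /\ `|v| <= cmod (u +i* v).
  split; rewrite /cmod /= -sqrtr_sqr ler_wsqrtr // ?lerDl ?lerDr ?sqr_ge0 //.
exists (u, v) => /=.
  by case: le_cmod; rewrite !in_itv /= -!ler_norml.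
by rewrite [RHS]complexE /=.
Qed.

Lemma aw_expansion_circle (q : R) (a : nat -> R[i]) (f : R[i] -> R[i])
    (rho e : R) : aw_expansion q a f -> 0 < e ->
  exists m0, forall m, (m0 <= m)%N -> forall x, cmod x = rho ->
    cmod (f x - \sum_(k < m) a k * aw_phi q k x) < e.
Proof.
move=> /fam_cvgP /(_ _ (@compact_complex_square rho)) cvf e0.
pose E := [set xy : (R[i])^o * (R[i])^o | `|xy.1 - xy.2| < e%:C].
have entE : entourage E.
  by rewrite -entourage_ballE; exists e%:C => //=; rewrite ltcR.
have := cvf _ (_ : nbhs _ [set h : {uniform` _ -> _} |
   forall y, complex_square rho y -> E (f y, h y)]).
case.
  by apply/uniform_nbhs; exists E; split.
move=> m0 _ H; exists m0 => m m0m x /circle_sub_square xr.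
by have := H m m0m x xr; rewrite /E /= lt_normc_real.
Qed.

End UniformConvergence.

(** * From log-order to decay of the terms *)

Section Growth.
Variable R : realType.

Lemma powR_large (p A : R) : 0 < p ->
  exists2 x0 : R, 1 <= x0 & forall x, x0 <= x -> A <= x `^ p.
Proof.
move=> p0; exists (Num.max 1 (`|A| `^ p^-1)); first by rewrite le_max lexx.
move=> x; rewrite ge_max => /andP[x1 Ax].
apply: le_trans (ler_norm A) _.
have -> : `|A| = (`|A| `^ p^-1) `^ p.
  by rewrite -powRrM mulVf ?gt_eqF // powRr1.
by rewrite ge0_ler_powR ?nnegrE ?powR_ge0 ?(ltW p0) // (le_trans _ x1).
Qed.

Lemma expR_ge2 : 2 <= expR 1 :> R.
Proof. by have := expR_ge1Dx (1 : R); lra. Qed.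

(** The supremum defining max_modulus is a genuine upper bound because f is
    within 1 of an Askey-Wilson polynomial on the circle, which is bounded. *)
Lemma max_modulus_ge (q : R) (a : nat -> R[i]) (f : R[i] -> R[i]) x :
  0 < q -> q < 1 -> aw_expansion q a f -> cmod (f x) <= max_modulus (cmod x) f.
Proof.
move=> q0 q1 ha; apply: ub_le_sup; last by exists x.
have [m Hm] := aw_expansion_circle (cmod x) ha ltr01.
exists (1 + \sum_(k < m) cmod (a k) * aw_radial q k (cmod x)) => _ [y /= yx <-].
have := cmodD (f y - \sum_(k < m) a k * aw_phi q k y)
              (\sum_(k < m) a k * aw_phi q k y).
rewrite subrK => /le_trans; apply; apply: lerD; first exact/ltW/Hm.
apply: le_trans (cmod_sum _) _; apply: ler_sum => k _.
by rewrite cmodM ler_wpM2l ?cmod_ge0 // cmod_aw_phi_le // yx.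
Qed.

Lemma log_order_growth (f : R[i] -> R[i]) (s : R) :
  (log_order f < (1 + s)%:E)%E ->
  exists2 T0 : R, 1 <= T0 & forall T, T0 <= T ->
    max_modulus (expR T) f <= expR (T `^ (1 + s)).
Proof.
rewrite /log_order limf_esupE => /ereal_inf_lt[_ [V [M [Mreal MV]] <-]] supV.
exists (Num.max (`|M| + 1) 2); first by rewrite le_max; apply/orP; right; lra.
move=> T; rewrite ge_max => /andP[TM T2].
have T0 : 0 < T by lra.
have VT : V (expR T).
  apply: MV; apply: le_lt_trans (ler_norm M) _.
  by have := expR_ge1Dx T; lra.
have lnT0 : 0 < ln T by rewrite ln_gt0 //; lra.
have : ((lnp (lnp (max_modulus (expR T) f)) / ln (ln (expR T)))%:E
          < (1 + s)%:E)%E.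
  by apply: le_lt_trans supV; apply: ereal_sup_ubound; exists (expR T).
rewrite lte_fin expRK ltr_pdivrMr // => H.
set Mf := max_modulus _ f in H *.
have lnln : ln (lnp Mf) <= (1 + s) * ln T.
  by apply: le_trans (ltW H); rewrite /lnp le_max lexx.
have le1 : lnp Mf <= T `^ (1 + s).
  have [l0|l0] := leP (lnp Mf) 0; first by rewrite (le_trans l0) // powR_ge0.
  rewrite -(@lnK _ (lnp Mf)) ?posrE // /powR gt_eqF //.
  by rewrite ler_expR.
have [Mf0|Mf0] := leP Mf 0; first by rewrite (le_trans Mf0) // expR_ge0.
rewrite -(@lnK _ Mf) ?posrE // ler_expR; apply: le_trans le1.
by rewrite /lnp le_max lexx.
Qed.

Lemma qV_expR (q : R) n : 0 < q -> q ^- n = expR (- ln q * n%:R).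
Proof.
move=> q0; rewrite expRM_natr expRN lnK ?posrE // exprVn //.
Qed.

(** On the circle |x| = e^T with T of order L + n, Cauchy's estimate opposes the
    growth e^(T^(1+s)) of f to a gain of e^(-nT). Since s < s', the power T^s is
    small against n as soon as n >= L^s', so the gain wins and even leaves a
    factor e^(-nL) to spare. *)
Lemma aw_term_decay (q : R) (a : nat -> R[i]) (f : R[i] -> R[i]) (s s' : R) :
  0 < q -> q < 1 -> aw_expansion q a f -> 0 < s -> s < s' ->
  s' < 1 -> (log_order f < (1 + s)%:E)%E ->
  exists2 L0 : R, 1 <= L0 & forall L n, L0 <= L -> L `^ s' <= n%:R ->
    aw_term q a (expR L) n <= expR (- (n%:R * L)).
Proof.
move=> q0 q1 ha s0 ss' s'1 hlog.
have [T0 T01 growth] := log_order_growth hlog.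
pose c := - ln q; have c0 : 0 < c by rewrite oppr_gt0 ln_lt0 // q0.
(* K / 2 = 8 + c exceeds the rates 2 of L and c + 6 of n, so that half of the
   gain e^(-nT) pays for everything but the growth of f. *)
pose K := 16 + 2 * c.
have s's : 0 < s' - s by rewrite subr_gt0.
have [L1 L11 HL1] := powR_large (2 * (2 * K) `^ s) s's.
exists (Num.max L1 T0); first by rewrite le_max L11.
move=> L n; rewrite ge_max => /andP[LL1 LT0] Ln.
have L1' : 1 <= L by apply: le_trans L11 LL1.
have s'0 : 0 < s' by lra.
have n1 : 1 <= n%:R :> R.
  by apply: le_trans Ln; rewrite -(powRr0 L) ler_powR // ltW.
have n0 : 0 < n%:R :> R by lra.
set T := K * (L + n%:R).
have T_gt0 : 0 < T by rewrite /T /K; nra.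
(* The growth exponent T^(1+s) uses at most the other half, n T / 2. *)
have Ts : T `^ s <= n%:R / 2.
  have nge : n%:R <= n%:R `^ s'^-1 :> R.
    by rewrite le1r_powR // invf_ge1 // ltW.
  have Lle : L <= n%:R `^ s'^-1.
    have -> : L = (L `^ s') `^ s'^-1.
      by rewrite -powRrM mulfV ?gt_eqF // powRr1 //; lra.
    by rewrite ge0_ler_powR ?nnegrE ?powR_ge0 ?invr_ge0 ?(ltW s'0) ?(ltW n0).
  have TK : T <= 2 * K * n%:R `^ s'^-1 by rewrite /T /K; nra.
  have K0 : 0 < 2 * K by rewrite /K; lra.
  apply: (@le_trans _ _ ((2 * K * n%:R `^ s'^-1) `^ s)).
    rewrite ge0_ler_powR ?nnegrE ?(ltW s0) ?(ltW T_gt0) //.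
    by rewrite mulr_ge0 ?powR_ge0 ?(ltW K0).
  rewrite powRM ?powR_ge0 ?(ltW K0) // -powRrM.
  have Hn : 2 * (2 * K) `^ s <= n%:R `^ (1 - s'^-1 * s).
    apply: le_trans (HL1 _ LL1) _.
    have -> : s' - s = s' * (1 - s'^-1 * s) by field; rewrite gt_eqF.
    rewrite powRrM ge0_ler_powR ?nnegrE ?powR_ge0 ?(ltW n0) //.
    by rewrite subr_ge0 mulrC ler_pdivrMr // mul1r ltW.
  have -> : n%:R / 2 = n%:R `^ (s'^-1 * s) * (n%:R `^ (1 - s'^-1 * s) / 2) :> R.
    rewrite mulrA -powRD; last by rewrite (gt_eqF n0) implybT.
    by rewrite addrC subrK powRr1 // ltW.
  rewrite mulrC ler_wpM2l ?powR_ge0 //; move: Hn; lra.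
pose B := expR (T `^ (1 + s)) + 1.
have rho1 : cmod (expR T)%:C = expR T by rewrite cmod_real ger0_norm ?expR_ge0.
have [m0 Hm0] := aw_expansion_circle (expR T) ha ltr01.
have circ x : cmod x = expR T ->
    cmod (\sum_(k < (maxn m0 n.+1)) a k * aw_phi q k x) <= B.
  move=> xT; set S := \sum_(k < _) _.
  have -> : S = f x - (f x - S) by ring.
  apply: le_trans (cmodB _ _) _; apply: lerD; last first.
    by apply/ltW/Hm0 => //; rewrite leq_maxl.
  apply: le_trans (max_modulus_ge x q0 q1 ha) _; rewrite xT; apply: growth.
  by rewrite /T /K; nra.
have qn : q ^+ n = expR (- (c * n%:R)).
  by rewrite expRN -qV_expR // invrK.
have key : 2 <= expR T * q ^+ n.
  rewrite qn -expRD; apply: le_trans expR_ge2 _; rewrite ler_expR.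
  by rewrite /T /K; nra.
have := aw_term_circle_le q0 q1 (_ : n < maxn m0 n.+1)%N (expR_ge0 L) circ key.
rewrite leq_maxr => /(_ isT) /le_trans; apply.
have e4 : 16 <= expR 4 :> R.
  have -> : (4 : R) = 4%:R * 1 by rewrite mulr1.
  rewrite expRM_natl; apply: (@le_trans _ _ (2 ^+ 4)); first by lra.
  by rewrite lerXn2r ?nnegrE ?expR_ge0 // expR_ge2.
have e2 : 4 <= expR 2 :> R.
  have -> : (2 : R) = 2%:R * 1 by rewrite mulr1.
  rewrite expRM_natl; apply: (@le_trans _ _ (2 ^+ 2)); first by lra.
  by rewrite lerXn2r ?nnegrE ?expR_ge0 // expR_ge2.
have leB : 2 * B <= expR (2 + T * T `^ s).
  rewrite expRD /B powRD ?(gt_eqF T_gt0) ?implybT // powRr1 ?(ltW T_gt0) //.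
  have : 1 <= expR (T * T `^ s).
    by rewrite -expR0 ler_expR mulr_ge0 ?powR_ge0 // ltW.
  by move: e2; nra.
have leX : 6 * (expR L + q ^- n) / expR T <= expR (4 + L + c * n%:R - T).
  rewrite qV_expR // -/c expRB ler_wpM2r ?invr_ge0 ?expR_ge0 //.
  rewrite -addrA expRD.
  have h1 : expR L <= expR (L + c * n%:R) by rewrite ler_expR; nra.
  have h2 : expR (c * n%:R) <= expR (L + c * n%:R) by rewrite ler_expR; nra.
  by have := expR_gt0 L; move: e4 h1 h2; nra.
have X0 : 0 <= 6 * (expR L + q ^- n) / expR T.
  rewrite divr_ge0 ?expR_ge0 // mulr_ge0 // addr_ge0 ?expR_ge0 //.
  by rewrite qV_expR // expR_ge0.
apply: (@le_trans _ _
  (expR (2 + T * T `^ s) * expR (4 + L + c * n%:R - T) ^+ n)).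
  apply: ler_pM => //; rewrite ?exprn_ge0 //.
    by rewrite mulr_ge0 // addr_ge0 // expR_ge0.
  by rewrite lerXn2r ?nnegrE ?expR_ge0.
rewrite -expRM_natl -expRD ler_expR.
have h1 : T * T `^ s <= T * (n%:R / 2) by rewrite ler_wpM2l // ltW.
have h2 : 12 + 4 * L + 2 * c * n%:R <= T by rewrite /T /K; nra.
by move: h1 h2 n1; nra.
Qed.

End Growth.

(** * The central index *)

Section CentralIndex.
Variables (R : realType) (q : R) (a : nat -> R[i]).
Hypotheses (q_gt0 : 0 < q) (q_lt1 : q < 1).
Implicit Types (r c : R) (m n : nat).

Lemma aw_term_ge0 r n : 0 <= r -> 0 <= aw_term q a r n.
Proof.
move=> r0; rewrite aw_termE // mulr_ge0 ?cmod_ge0 //.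
by rewrite ltW // aw_radial_gt0.
Qed.

Lemma le_aw_term r1 r2 n : 0 <= r1 -> r1 <= r2 ->
  aw_term q a r1 n <= aw_term q a r2 n.
Proof.
by move=> r0 r12; rewrite !aw_termE // ler_wpM2l ?cmod_ge0 // le_aw_radial.
Qed.

Lemma max_modulus_aw_phi r n : 0 <= r ->
  max_modulus r (fun x => a n * aw_phi q n x) = aw_term q a r n.
Proof.
move=> r0; rewrite /max_modulus aw_termE //; set S := [set _ | _ in _].
have ubS : ubound S (cmod (a n) * aw_radial q n r).
  move=> _ [x /= xr <-]; rewrite cmodM ler_wpM2l ?cmod_ge0 //.
  by rewrite cmod_aw_phi_le // xr.
have Sr : S (cmod (a n) * aw_radial q n r).
  exists (- r%:C); first by rewrite /mkset cmodN cmod_real ger0_norm.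
  by rewrite cmodM cmod_aw_phi_neg.
apply/eqP; rewrite eq_le ge_sup //=; last by eexists; exact: Sr.
by apply: ub_le_sup => //; eexists; exact: ubS.
Qed.

(** How the ratio of two terms changes with the radius: only the factors of
    index between m and n enter. *)
Lemma aw_radial_ratio_le r1 r2 c m n : 0 <= r1 -> 0 <= r2 -> (m <= n)%N ->
  (forall k, (m <= k < n)%N -> aw_factor q k r1 <= c * aw_factor q k r2) ->
  aw_radial q n r1 * aw_radial q m r2 <=
    c ^+ (n - m) * (aw_radial q m r1 * aw_radial q n r2).
Proof.
move=> r10 r20; elim: n => [|n IH] mn Fc.
  by move: mn; rewrite leqn0 => /eqP ->; rewrite expr0 mul1r.
have [nm|nm] := leqP n.+1 m.
  have -> : m = n.+1 by lia.
  by rewrite subnn mul1r.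
have {}IH := IH nm (fun k kmn => Fc k ltac:(lia)).
rewrite !aw_radialS subSn // exprS.
have Fn := Fc n ltac:(lia).
have F1 := aw_factor_gt0 q_gt0 n r10; have P1 := aw_radial_gt0 q_gt0 n r10.
have P2 := aw_radial_gt0 q_gt0 m r20.
have := ler_pM (ltW (mulr_gt0 P1 P2)) (ltW F1) IH Fn.
set u := _ * _ ; set v := _ * _ => uv.
have -> : aw_radial q n r1 * aw_factor q n r1 * aw_radial q m r2 = u.
  by rewrite /u mulrAC.
by apply: (le_trans uv); rewrite /v; apply: eq_ler; ring.
Qed.

(** While r1 q^k >= 1 the factor is at most twice the monomial 2 r q^k, hence
    proportional to the radius up to a factor 2. For larger k it tends to 1 and
    this comparison breaks down. *)
Lemma aw_factor_ratio_le r1 r2 k : 0 < r1 -> 0 < r2 -> 1 <= r1 * q ^+ k ->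
  aw_factor q k r1 <= 2 * r1 / r2 * aw_factor q k r2.
Proof.
move=> r10 r20 r1k; apply: le_trans (aw_factor_le q_gt0 q_lt1 _ _) _.
rewrite [leRHS]mulrAC ler_pdivlMr // /aw_factor.
have := qX_gt0 q_gt0 (2 * k); have := qX_gt0 q_gt0 k.
move: (q ^+ k) (q ^+ (2 * k)) r1k => u v r1k u0 v0.
have : 0 <= r2 * (r1 * u - 1) by rewrite mulr_ge0 ?subr_ge0 // ltW.
have : 0 <= r1 * v by rewrite mulr_ge0 // ltW.
nra.
Qed.

Hypothesis a_infinite : forall n0, exists2 n, (n0 <= n)%N & a n != 0.
Variables (L0 p : R).
Hypotheses (L0_ge1 : 1 <= L0) (p_gt0 : 0 < p).
Hypothesis term_decay : forall L n, L0 <= L -> L `^ p <= n%:R ->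
  aw_term q a (expR L) n <= expR (- (n%:R * L)).

Let t n r := aw_term q a r n.
Let N := aw_central_index q a.

Lemma aw_term_eventually_lt r e : 0 < r -> 0 < e ->
  exists B, forall n, (B <= n)%N -> t n r < e.
Proof.
move=> r0 e0; pose L := Num.max L0 (ln r).
have LL0 : L0 <= L by rewrite le_max lexx.
exists (Num.trunc (Num.max (L `^ p) (- ln e))).+1 => n Bn.
have : Num.max (L `^ p) (- ln e) < n%:R.
  by apply: (lt_le_trans (truncnS_gt _)); rewrite ler_nat.
rewrite gt_max => /andP[Ln en].
have rL : r <= expR L.
  by rewrite -{1}(@lnK _ r) ?posrE // ler_expR le_max lexx orbT.
apply: (le_lt_trans (le_aw_term _ (ltW r0) rL)).
apply: (le_lt_trans (term_decay LL0 (ltW Ln))).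
rewrite -(@lnK _ e) ?posrE // ltr_expR ltrNl (lt_le_trans en) //.
by rewrite ler_peMr // (le_trans L0_ge1).
Qed.

Lemma aw_term_positive r : 0 < r -> exists n, 0 < t n r.
Proof.
move=> r0; have [n _ an] := a_infinite 0; exists n.
rewrite /t aw_termE // mulr_gt0 ?aw_radial_gt0 ?(ltW r0) //.
by rewrite lt_def cmod_eq0 an cmod_ge0.
Qed.

(** Both the supremum and the choice in the definitions are attained: the terms
    tend to 0, one of them is positive, so only finitely many can compete. *)
Lemma aw_central_indexP r : 0 < r ->
  [/\ aw_max_term q a r = t (N r) r,
      forall m, t m r <= t (N r) r &
      forall m, (N r < m)%N -> t m r < t (N r) r].
Proof.
move=> r0; have [n1 tn1] := aw_term_positive r0.
have [B HB] := aw_term_eventually_lt r0 tn1.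
have n1B : (n1 < B)%N.
  by rewrite ltnNge; apply/negP => /HB; rewrite ltxx.
pose P n := `[< forall m, t m r <= t n r >].
have exP : exists n, P n.
  pose i1 : 'I_B := Ordinal n1B.
  have [i _ imax] := arg_maxP (fun i : 'I_B => t i r) (isT : xpredT i1).
  exists i; apply/asboolP => m; have [Bm|mB] := leqP B m.
    exact: (le_trans (ltW (HB m Bm)) (imax i1 isT)).
  exact: (imax (Ordinal mB) isT).
have bdP n : P n -> (n <= B)%N.
  move=> /asboolP Pn; rewrite leqNgt; apply/negP => /ltnW/HB.
  by rewrite ltNge Pn.
case: (ex_maxnP exP bdP) => n /asboolP nmax nlast.
have maxE : aw_max_term q a r = t n r.
  rewrite /aw_max_term; set S := [set _ | _ in _].
  have ubS : ubound S (t n r).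
    by move=> _ [m _ <-]; rewrite max_modulus_aw_phi ?(ltW r0) //; exact: nmax.
  have Sn : S (t n r) by exists n => //; rewrite max_modulus_aw_phi ?(ltW r0).
  apply/eqP; rewrite eq_le ge_sup //=; last by exists (t n r).
  by apply: ub_le_sup => //; exists (t n r).
have NE : N r = n.
  rewrite /N /aw_central_index; apply: xget_unique.
    split=> [|m Hm]; first by rewrite maxE.
    by apply: nlast; apply/asboolP => k; rewrite /t Hm maxE; exact: nmax.
  move=> m [Hm mlast]; apply/eqP; rewrite eqn_leq; apply/andP; split.
    by apply: nlast; apply/asboolP => k; rewrite /t Hm maxE; exact: nmax.
  by apply: mlast; rewrite maxE.
rewrite NE; split=> // m nm; rewrite lt_neqAle nmax andbT; apply/eqP => tmn.
have : (m <= n)%N by apply: nlast; apply/asboolP => k; rewrite tmn.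
by rewrite leqNgt nm.
Qed.

(** Raising the radius favours the larger index, as the quotient of the terms of
    indices n > m is nondecreasing in r. *)
Lemma le_aw_central_index r1 r2 : 0 < r1 -> r1 <= r2 -> (N r1 <= N r2)%N.
Proof.
move=> r10 r12; have r20 := lt_le_trans r10 r12.
have [_ max1 _] := aw_central_indexP r10.
have [_ _ last2] := aw_central_indexP r20.
rewrite leqNgt; apply/negP => N21; move: (last2 _ N21); apply/negP.
rewrite -leNgt; move: (max1 (N r2)) N21.
move: (N r1) (N r2) => n m le1 mn.
have := @aw_radial_ratio_le r1 r2 1 m n (ltW r10) (ltW r20) (ltnW mn).
rewrite expr1n mul1r => /(_ (fun k _ => _)) ratio.
have {}ratio : aw_radial q n r1 * aw_radial q m r2 <=
               aw_radial q m r1 * aw_radial q n r2.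
  by apply: ratio => k; rewrite mul1r le_aw_factor.
move: le1; rewrite /t !aw_termE //.
have Pm1 := aw_radial_gt0 q_gt0 m (ltW r10).
have Pm2 := aw_radial_gt0 q_gt0 m (ltW r20).
move=> le1; rewrite -(ler_pM2r Pm1).
have h1 := ler_wpM2r (ltW Pm2) le1.
have h2 := ler_wpM2l (cmod_ge0 (a n)) ratio.
by move: h1 h2; nra.
Qed.

(** A nonzero term of index n outgrows the finitely many terms before it, each
    by at least a factor of order r. *)
Lemma aw_central_index_unbounded n0 :
  exists2 r0, 1 <= r0 & forall r, r0 <= r -> (n0 <= N r)%N.
Proof.
have [n nn0 an] := a_infinite n0.
have an0 : 0 < cmod (a n) by rewrite lt_def cmod_eq0 an cmod_ge0.
have qn := qX_gt0 q_gt0 n.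
pose S := \sum_(m < n) cmod (a m).
exists (1 + S / (cmod (a n) * q ^+ n)).
  rewrite lerDl divr_ge0 ?mulr_ge0 ?(ltW qn) ?cmod_ge0 //.
  by apply: sumr_ge0 => *; exact: cmod_ge0.
move=> r rS; have S0 : 0 <= S by apply: sumr_ge0 => *; exact: cmod_ge0.
have D0 : 0 <= S / (cmod (a n) * q ^+ n) by rewrite divr_ge0 // mulr_ge0 // ltW.
have r0 : 0 < r by lra.
have [_ rmax rlast] := aw_central_indexP r0.
apply: (leq_trans nn0); rewrite leqNgt; apply/negP => Nn.
have : t n r <= t (N r) r by exact: rmax.
apply/negP; rewrite -ltNge /t !aw_termE //.
move: (N r) Nn => m mn.
have am : cmod (a m) <= S.
  rewrite /S (bigD1 (Ordinal mn)) //= lerDl.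
  by apply: sumr_ge0 => *; exact: cmod_ge0.
have PP : aw_radial q m r * (r * q ^+ n) <= aw_radial q n r.
  elim: n mn {an an0 nn0 qn S rS S0 D0 am} => // n IH; rewrite ltnS leq_eqVlt.
  have Pn := aw_radial_gt0 q_gt0 n (ltW r0).
  have qn := qX_gt0 q_gt0 n; have qn2 := qX_gt0 q_gt0 (2 * n).
  move=> /orP[/eqP ->|mn].
    rewrite aw_radialS ler_pM2l // exprS /aw_factor.
    have ru : 0 < r * q ^+ n by rewrite mulr_gt0.
    move: ru qn2; rewrite mulrCA -[2 * r * _]mulrA.
    move: (r * q ^+ n) => u u0 v0.
    have : 0 <= (1 - q) * u by rewrite mulr_ge0 ?subr_ge0 // ltW.
    nra.
  have {}IH := IH mn; rewrite aw_radialS exprS.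
  have F1 : 1 <= aw_factor q n r by rewrite /aw_factor; nra.
  have Pm := aw_radial_gt0 q_gt0 m (ltW r0).
  apply: (@le_trans _ _ (aw_radial q n r)); last by rewrite ler_peMr // ltW.
  apply: le_trans IH; rewrite ler_pM2l // ler_pM2l // ger_pMl // ltW //.
have Pm := aw_radial_gt0 q_gt0 m (ltW r0).
apply: (lt_le_trans _ (ler_wpM2l (ltW an0) PP)).
rewrite mulrCA mulrC ltr_pM2l //; apply: (le_lt_trans am).
have : S / (cmod (a n) * q ^+ n) < r by lra.
by rewrite ltr_pdivrMr ?mulr_gt0 //; nra.
Qed.

Lemma aw_max_term_lower :
  exists2 eta : R, 0 < eta & forall r, 1 <= r -> eta <= t (N r) r.
Proof.
have [n tn] := aw_term_positive ltr01.
exists (t n 1) => // r r1; have r0 : 0 < r by lra.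
have [_ rmax _] := aw_central_indexP r0.
by apply: le_trans (rmax n); rewrite le_aw_term.
Qed.

(** An index beyond L^p has a term below e^(-L), which cannot be maximal since
    the maximal term is bounded below. *)
Lemma aw_central_index_lt_powR :
  exists2 L1 : R, L0 <= L1 & forall L, L1 <= L -> (N (expR L))%:R < L `^ p.
Proof.
have [eta eta0 Heta] := aw_max_term_lower.
exists (Num.max L0 (1 - ln eta)); first by rewrite le_max lexx.
move=> L; rewrite ge_max => /andP[LL0 Leta].
have L1 : 1 <= L by apply: le_trans LL0.
rewrite ltNge; apply/negP => NL.
have := term_decay LL0 NL; apply/negP; rewrite -ltNge.
have e1 : 1 <= expR L by rewrite -expR0 ler_expR; lra.
apply: (lt_le_trans _ (Heta _ e1)).
rewrite -(@lnK _ eta) ?posrE // ltr_expR.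
have n1 : 1 <= (N (expR L))%:R :> R.
  by apply: le_trans NL; rewrite -(powRr0 L) ler_powR // ltW.
by nra.
Qed.

End CentralIndex.

(** * Windows free of jumps *)

Section SparseJumps.
Variable R : realType.
Variables (G : nat -> nat) (p : R) (j0 : nat).
Hypotheses (G_homo : forall i j, (i <= j)%N -> (G i <= G j)%N).
Hypotheses (p_gt0 : 0 < p) (p_lt1 : p < 1).
Hypothesis G_lt : forall j, (j0 <= j)%N -> (G j)%:R <= (j%:R : R) `^ p.

(** The half-width of the windows, a power of m small enough for windows around
    the M^p jumps before M to cover o(M). *)
Definition jump_window m : nat := Num.trunc ((m%:R : R) `^ ((1 - p) / 2)).

Definition jump_near m : bool :=
  G (m - jump_window m) != G (m + (jump_window m).+1).

Definition jump_set : set R :=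
  [set x | 1 <= x /\ jump_near (Num.trunc (ln x))].

Let expo_gt0 : 0 < (1 - p) / 2. Proof. by rewrite divr_gt0 ?subr_gt0. Qed.

Lemma jump_window_le m : ((jump_window m)%:R : R) <= m%:R `^ ((1 - p) / 2).
Proof. by rewrite truncn_le powR_ge0. Qed.

Lemma jump_window_leq m : (jump_window m <= m)%N.
Proof.
case: m => [|m]; first by rewrite /jump_window powR0 ?gt_eqF // truncn0.
rewrite -(ler_nat R); apply: le_trans (jump_window_le _) _.
have m1 : 1 <= m.+1%:R :> R by rewrite ler1n.
by apply: ler1_powR => //; have := p_gt0; lra.
Qed.

Lemma le_jump_window : {homo jump_window : m n / (m <= n)%N}.
Proof.
move=> m n mn; apply: le_truncn.
by rewrite ge0_ler_powR ?nnegrE ?ler_nat // ltW.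
Qed.

(** A jump inside the window of m also lies inside any wider window. *)
Lemma jump_near_step m v : (jump_window m <= v)%N ->
  (jump_near m + G (m - v) <= G (m + v.+1))%N.
Proof.
move=> wv.
have h1 : (G (m - v) <= G (m - jump_window m))%N by apply: G_homo; lia.
have h2 : (G (m + (jump_window m).+1) <= G (m + v.+1))%N by apply: G_homo; lia.
have h3 : (G (m - jump_window m) <= G (m + (jump_window m).+1))%N.
  by apply: G_homo; lia.
rewrite /jump_near; case: eqP => /= neq; lia.
Qed.

(** The sums over shifted windows telescope: widening the window by one on
    each side adds at most G (M + v) twice. *)
Lemma sum_shift_le M v :
  (\sum_(m < M) G (m + v.+1) <= \sum_(m < M) G (m - v) + v.*2.+1 * G (M + v))%N.
Proof.
have tele (H : nat -> nat) :
    (\sum_(m < M) H m.+1 + H 0 = \sum_(m < M) H m + H M)%N.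
  by elim: M => [|M IH]; rewrite ?big_ord0 // !big_ord_recr /= addnAC IH.
elim: v => [|v IH].
  have e1 : (\sum_(m < M) G (m + 1) = \sum_(m < M) G m.+1)%N.
    by apply: eq_bigr => m _; rewrite addn1.
  have e2 : (\sum_(m < M) G (m - 0) = \sum_(m < M) G m)%N.
    by apply: eq_bigr => m _; rewrite subn0.
  by rewrite e1 e2 addn0 mul1n -tele leq_addr.
have t1 := tele (fun m => G (m + v.+1)).
have t2 := tele (fun m => G (m - v.+1)).
rewrite /= in t1 t2.
have e1 : (\sum_(m < M) G (m + v.+2) = \sum_(m < M) G (m.+1 + v.+1))%N.
  by apply: eq_bigr => m _; rewrite addSnnS.
have e2 : (\sum_(m < M) G (m.+1 - v.+1) = \sum_(m < M) G (m - v))%N.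
  by apply: eq_bigr => m _; rewrite subSS.
have g1 : (G (M - v.+1) <= G (M + v.+1))%N by apply: G_homo; lia.
have g2 : (G (M + v) <= G (M + v.+1))%N by apply: G_homo; lia.
have g3 := leq_mul (leqnn v.*2.+1) g2.
rewrite e1 doubleS !mulSn; rewrite mulSn in IH; rewrite mulSn in g3.
move: t1 t2 IH g1 g2 g3; rewrite e2 mulSn.
move: (\sum_(m < M) _)%N (\sum_(m < M) _)%N (\sum_(m < M) _)%N.
move: (\sum_(m < M) _)%N (_ * _)%N (_ * _)%N; lia.
Qed.

Lemma jump_count_le M :
  (\sum_(m < M) jump_near m <=
     (jump_window M).*2.+1 * G (M + jump_window M))%N.
Proof.
have := sum_shift_le M (jump_window M).
have : (\sum_(m < M) (jump_near m + G (m - jump_window M)) <=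
        \sum_(m < M) G (m + (jump_window M).+1))%N.
  apply: leq_sum => m _; apply: jump_near_step.
  by apply: le_jump_window; rewrite ltnW.
by rewrite big_split /=; lia.
Qed.

Definition exp_interval m : set R := `[expR m%:R, expR m.+1%:R[.

Lemma exp_intervalP m x : exp_interval m x <-> 1 <= x /\ Num.trunc (ln x) = m.
Proof.
rewrite /exp_interval /= in_itv /=; split=> [/andP[xm xM]|[x1 <-]].
  have x0 : 0 < x by apply: lt_le_trans xm; exact: expR_gt0.
  split; first by apply: le_trans xm; rewrite -expR0 ler_expR.
  apply: truncn_def; rewrite -ler_expR -ltr_expR !lnK ?posrE //.
  by rewrite xm xM.
have /andP[] := truncn_itv (ln_ge0 x1).
have x0 : 0 < x by lra.
rewrite -[X in _ -> _ -> (_ <= X < _)](@lnK _ x) ?posrE //.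
by rewrite ler_expR ltr_expR => -> ->.
Qed.

Lemma jump_setE :
  jump_set = \bigcup_(m in [set m | jump_near m]) exp_interval m.
Proof.
apply/seteqP; split=> x /=.
  by move=> [x1 bx]; exists (Num.trunc (ln x)) => //; apply/exp_intervalP.
by move=> [m bm /exp_intervalP[x1 xm]]; split=> //; rewrite xm.
Qed.

Lemma measurable_jump_set : measurable jump_set.
Proof.
by rewrite jump_setE; apply: bigcup_measurable => m _; exact: measurable_itv.
Qed.

Lemma measurable_inv_above (c : R) (I : set R) : 0 < c -> measurable I ->
  I `<=` [set x | c <= x] ->
  measurable_fun I (fun x : R => x^-1).
Proof.
move=> c0 mI Ic.
pose E : set R := [set x | x \in `]0, +oo[%R].
refine (@measurable_funS _ _ _ _ E I _ _ _ _); rewrite /E.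
- exact: measurable_itv.
- by move=> x /Ic /= cx; rewrite in_itv /= andbT (lt_le_trans c0).
apply: open_continuous_measurable_fun => [|x].
  exact: interval_open.
rewrite inE /= in_itv /= andbT => x0.
by apply: inv_continuous; rewrite gt_eqF.
Qed.

Lemma integral_exp_interval_le m :
  (\int[lebesgue_measure]_(x in exp_interval m) (x^-1)%:E <= (expR 1)%:E)%E.
Proof.
have mI : measurable (exp_interval m) by exact: measurable_itv.
have e0 := expR_gt0 (m%:R : R).
have Ic : exp_interval m `<=` [set x | expR m%:R <= x].
  by move=> x; rewrite /exp_interval /= in_itv /= => /andP[].
apply: (@le_trans _ _ (\int[lebesgue_measure]_(x in exp_interval m)
          (cst ((expR m%:R)^-1)%:E) x)%E).
  apply: ge0_le_integral => //.
  - move=> x /exp_intervalP[x1 _]; rewrite lee_fin invr_ge0; lra.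
  - by apply/measurable_EFinP; exact: measurable_inv_above e0 mI Ic.
  - move=> x /Ic /= xm.
    by rewrite lee_fin lef_pV2 ?posrE // (lt_le_trans e0).
rewrite integral_cst //= /exp_interval lebesgue_measure_itv /= lte_fin ltr_expR.
rewrite ltr_nat ltnSn -EFinD -EFinM lee_fin -natr1 expRD.
have -> : (expR m%:R)^-1 * (expR m%:R * expR 1 - expR m%:R) = expR 1 - 1 :> R.
  by field; rewrite gt_eqF.
by rewrite gerBl.
Qed.

Lemma trivIset_exp_interval : trivIset setT exp_interval.
Proof.
apply/trivIsetP => i j _ _ ij; apply/seteqP; split=> // x [].
move=> /exp_intervalP[_ xi] /exp_intervalP[_ xj].
by move: ij; rewrite -xi -xj eqxx.
Qed.

Lemma integral_jump_set_le (r : R) : 1 <= r ->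
  (\int[lebesgue_measure]_(x in jump_set `&` `[1%R, r]) (x^-1)%:E <=
    ((\sum_(m < (Num.trunc (ln r)).+1) jump_near m)%:R * expR 1)%:E)%E.
Proof.
move=> r1; set K := (Num.trunc (ln r)).+1.
pose s := [seq m <- iota 0 K | jump_near m].
pose U := \big[setU/set0]_(m <- s) exp_interval m.
have mI m : measurable (exp_interval m) by exact: measurable_itv.
have mU : measurable U by apply: bigsetU_measurable.
have U1 : U `<=` [set x | 1 <= x].
  by move=> x; rewrite /U -bigcup_seq => -[m _ /exp_intervalP[]].
have subU : jump_set `&` `[1%R, r] `<=` U.
  move=> x [[x1 bx] /=]; rewrite in_itv /= => /andP[_ xr].
  rewrite /U -bigcup_seq; exists (Num.trunc (ln x)); last exact/exp_intervalP.
  rewrite /= mem_filter bx mem_iota /= ltnS; apply: le_truncn.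
  by rewrite ler_ln ?posrE //; lra.
have f0 x : U x -> (0 <= (x^-1)%:E)%E.
  by move=> /U1 /= x1; rewrite lee_fin invr_ge0; lra.
have mf : measurable_fun U (fun x : R => x^-1).
  exact: measurable_inv_above ltr01 mU U1.
apply: (@le_trans _ _ (\int[lebesgue_measure]_(x in U) (x^-1)%:E)%E).
  apply: ge0_subset_integral => //; last exact/measurable_EFinP.
  by apply: measurableI; [exact: measurable_jump_set|exact: measurable_itv].
have -> : (\int[lebesgue_measure]_(x in U) (x^-1)%:E =
    \sum_(m <- s) \int[lebesgue_measure]_(x in exp_interval m) (x^-1)%:E)%E.
  apply: ge0_integral_bigsetU => //; first by rewrite filter_uniq ?iota_uniq.
    exact: sub_trivIset trivIset_exp_interval.
  exact/measurable_EFinP.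
apply: (@le_trans _ _ (\sum_(m <- s) (expR 1)%:E)%E).
  by apply: lee_sum => m _; exact: integral_exp_interval_le.
rewrite sumEFin lee_fin /s big_filter.
rewrite -(big_mkord xpredT (fun m => jump_near m : nat)).
rewrite natr_sum mulr_suml /index_iota subn0 [leLHS]big_mkcond /=.
apply: ler_sum => m _.
by case: jump_near; rewrite ?mul1r ?mul0r.
Qed.

(** Up to M there are at most about M^p jumps, each seen from windows of
    half-width M^((1-p)/2); the total exponent (1+p)/2 is below 1. *)
Lemma jump_count_sublinear (e : R) : 0 < e ->
  exists2 L1 : R, 1 <= L1 & forall L, L1 <= L ->
    (\sum_(m < (Num.trunc L).+1) jump_near m)%:R <= e * L.
Proof.
move=> e0; have ep : 0 < (1 - p) / 2 := expo_gt0.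
have [L1 L11 HL1] := powR_large (12 / e) ep.
exists (Num.max L1 j0%:R); first by rewrite le_max L11.
move=> L; rewrite ge_max => /andP[LL1 Lj0].
have L1' : 1 <= L by apply: le_trans L11 LL1.
have L0 : 0 <= L by lra.
set M := (Num.trunc L).+1.
have ML : M%:R <= 4 * L.
  have /andP[tL _] := truncn_itv L0.
  by rewrite /M -natr1; lra.
have LM : L < M%:R by exact: truncnS_gt.
have ML2 : (M + jump_window M)%:R <= 4 * L.
  apply: (@le_trans _ _ (M + M)%:R).
    by rewrite ler_nat leq_add2l jump_window_leq.
  have /andP[tL _] := truncn_itv L0.
  by rewrite natrD /M -natr1; lra.
have L40 : 0 <= 4 * L by lra.
have L41 : 1 <= 4 * L by lra.
have w_le : (jump_window M)%:R <= (4 * L) `^ ((1 - p) / 2).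
  apply: le_trans (jump_window_le _) _.
  by rewrite ge0_ler_powR ?nnegrE // ltW.
have G_le : (G (M + jump_window M))%:R <= (4 * L) `^ p.
  apply: le_trans (G_lt _) _.
    apply: (@leq_trans M); last by rewrite leq_addr.
    by rewrite -(ler_nat R); apply: (le_trans Lj0); rewrite ltW.
  by rewrite ge0_ler_powR ?nnegrE ?(ltW p_gt0).
have w1 : 1 <= (4 * L) `^ ((1 - p) / 2).
  by rewrite -[leLHS](powRr0 (4 * L)) ler_powR // ltW.
have := jump_count_le M; rewrite -(ler_nat R) => /le_trans; apply.
rewrite natrM.
apply: (@le_trans _ _ (3 * (4 * L) `^ ((1 - p) / 2) * (4 * L) `^ p)).
  apply: ler_pM => //.
  by rewrite -natr1 -muln2 natrM; move: w_le w1; lra.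
have key : 12 / e <= (4 * L) `^ ((1 - p) / 2).
  apply: le_trans (HL1 _ LL1) _.
  by rewrite ge0_ler_powR ?nnegrE // ?(ltW ep) //; lra.
have -> : e * L = (e / 4) * (4 * L) by field.
have {3}-> : 4 * L =
    (4 * L) `^ ((1 - p) / 2) * (4 * L) `^ ((1 - p) / 2) * (4 * L) `^ p.
  rewrite -!powRD ?(gt_eqF (_ : 0 < 4 * L)) ?implybT //; try lra.
  have -> : (1 - p) / 2 + (1 - p) / 2 + p = 1 by field.
  by rewrite powRr1.
rewrite !mulrA ler_wpM2r ?powR_ge0 // ler_wpM2r ?powR_ge0 //.
by move: key; rewrite ler_pdivrMr //; lra.
Qed.

Lemma log_density_jump_set : log_density jump_set = 0%E.
Proof.
apply/eqP; rewrite eq_le; apply/andP; split; last first.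
  rewrite /log_density limf_esupE.
  apply: le_ereal_inf_tmp => _ [V [M [_ MV]] <-].
  pose r := Num.max (M + 1) 2.
  have r2 : 2 <= r by rewrite le_max lexx orbT.
  apply: le_ereal_sup_tmp; eexists.
    exists r; last by [].
    by apply: MV; rewrite lt_max ltrDl ltr01.
  apply: mule_ge0; first by rewrite lee_fin invr_ge0 ln_ge0 //; lra.
  apply: integral_ge0 => x [[x1 _] _]; rewrite lee_fin invr_ge0; lra.
apply/lee_addgt0Pr => e e0; rewrite add0e.
have e10 : 0 < e / expR 1 by rewrite divr_gt0 ?expR_gt0.
have [L1 L11 HL1] := jump_count_sublinear e10.
rewrite /log_density limf_esupE.
apply: (@le_trans _ _ (ereal_sup ((fun r : R => ((ln r)^-1)%:E *
    \int[lebesgue_measure]_(x in jump_set `&` `[1%R, r]) (x^-1)%:E)%E @`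
    [set x | expR L1 < x]))).
  apply: ereal_inf_lbound; exists [set x | expR L1 < x] => //.
  by exists (expR L1); split=> //; exact: num_real.
apply: ge_ereal_sup => _ [r /= rL <-].
have r0 : 0 < r by apply: lt_trans rL; exact: expR_gt0.
have Lr : L1 <= ln r by rewrite -ler_expR lnK ?posrE // ltW.
have lnr0 : 0 < ln r by lra.
have r1 : 1 <= r by rewrite -(@lnK _ r) ?posrE // -expR0 ler_expR ltW.
have := integral_jump_set_le r1.
move=> /(lee_wpmul2l (_ : (0 <= ((ln r)^-1)%:E)%E)).
rewrite lee_fin invr_ge0 (ltW lnr0) => /(_ isT) /le_trans; apply.
rewrite -EFinM lee_fin mulrC ler_pdivrMr //.
have := HL1 _ Lr; rewrite -(ler_pM2r (expR_gt0 1)) => /le_trans; apply.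
by rewrite mulrAC divfK // gt_eqF ?expR_gt0.
Qed.

End SparseJumps.

(** Windows grow without bound, yet both their half-width and L^p are powers of
    L with exponent below 1, so the lower end of a window around [L] stays above
    any multiple of L^p. *)
Lemma jump_window_large (R : realType) (p A c : R) : 0 < p -> p < 1 -> 0 < c ->
  exists2 X : R, 1 <= X & forall L, X < L ->
    let m := Num.trunc L in
    [/\ (jump_window p m <= m)%N, A <= (jump_window p m)%:R &
        c * L `^ p <= (m - jump_window p m)%:R].
Proof.
move=> p_gt0 p_lt1 c0.
pose ex := (1 - p) / 2; have ex0 : 0 < ex by rewrite divr_gt0 ?subr_gt0.
have ex1 : 0 < 1 - ex by rewrite /ex; lra.
have p1 : 0 < 1 - p by rewrite subr_gt0.
have [x1 x11 H1] := powR_large (A + 1) ex0.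
have [x2 x21 H2] := powR_large 2 ex1.
have [x3 x31 H3] := powR_large (4 * c) p1.
pose X := Num.max x1 (Num.max x2 x3).
have [X1 X2 X3] : [/\ x1 <= X, x2 <= X & x3 <= X].
  by rewrite /X !le_max !lexx !orbT.
clearbody X; exists (X + 1); first by lra.
move=> L LX; have L_0 : 0 <= L by lra.
have /andP[mL Lm] := truncn_itv L_0.
move: (Num.trunc L) mL Lm => m mL Lm /=.
have Xm : X <= m%:R by move: Lm; rewrite -natr1; lra.
have m0 : 0 < m%:R :> R by lra.
have vm := jump_window_leq p_gt0 p_lt1 m.
have vle := jump_window_le p m; rewrite -/ex in vle.
have vgt : m%:R `^ ex < (jump_window p m)%:R + 1.
  by rewrite natr1; exact: truncnS_gt.
move: (jump_window p m) vm vle vgt => v vm vle vgt.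
have vhalf : v%:R <= m%:R / 2 :> R.
  apply: le_trans vle _.
  have m2 := H2 _ (le_trans X2 Xm).
  have {2}-> : m%:R = m%:R `^ ex * m%:R `^ (1 - ex) :> R.
    rewrite -powRD ?(gt_eqF m0) ?implybT // addrC subrK powRr1 //; exact: ltW.
  have := powR_gt0 ex m0; move: m2.
  by move: (_ `^ ex) (_ `^ (1 - ex)) => y z; nra.
split=> //; first by have := H1 _ (le_trans X1 Xm); lra.
rewrite natrB //; apply: (@le_trans _ _ (m%:R / 2)); last by lra.
have L2m : L <= 2 * m%:R by move: Lm; rewrite -natr1; lra.
have m20 : 0 < 2 * m%:R :> R by lra.
apply: (@le_trans _ _ (c * (2 * m%:R) `^ p)).
  by rewrite ler_wpM2l ?(ltW c0) // ge0_ler_powR ?nnegrE ?(ltW p_gt0) // ltW.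
have hh : 4 * c <= (2 * m%:R) `^ (1 - p) by apply: H3; lra.
have -> : m%:R / 2 = (2 * m%:R) `^ p * (2 * m%:R) `^ (1 - p) / 4 :> R.
  rewrite -powRD ?(gt_eqF m20) ?implybT // addrC subrK powRr1 ?(ltW m20) //.
  by field.
have := powR_gt0 p m20; move: hh.
by move: (_ `^ p) (_ `^ (1 - p)) => y z; nra.
Qed.

(** * Weights and geometric tails *)

Section FinalSum.
Variable R : realType.

(** The distance of k and N: one of the truncated differences is 0. *)
Definition index_gap k N := ((k - N) + (N - k))%N.

Lemma index_gap_low k N : (k <= N)%N -> index_gap k N = (N - k)%N.
Proof. by rewrite /index_gap; lia. Qed.

Lemma index_gap_high k N : (N <= k)%N -> index_gap k N = (k - N)%N.
Proof. by rewrite /index_gap; lia. Qed.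

Lemma norm_subz_index_gap k N : `|k%:Z - N%:Z| = (index_gap k N)%:Z.
Proof. by rewrite /index_gap; lia. Qed.

Lemma sum_half_index_gap_le N n : \sum_(k < n) (2^-1 : R) ^+ index_gap k N <= 3.
Proof.
have below i : (i <= N)%N ->
    \sum_(k < i) (2^-1 : R) ^+ index_gap k N <= 2^-1 ^+ (N - i).
  elim: i => [|i IH] iN; first by rewrite big_ord0 exprn_ge0.
  rewrite big_ord_recr /=.
  rewrite (index_gap_low (ltnW iN)).
  have := IH (ltnW iN); have -> : (N - i = (N - i.+1).+1)%N by lia.
  by rewrite exprS; move: (_ ^+ (N - i.+1)) => y; lra.
have above i :
    \sum_(k < N + i) (2^-1 : R) ^+ index_gap k N <= 3 - 2 * 2^-1 ^+ i.
  elim: i => [|i IH].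
    by rewrite addn0 expr0; have := below N (leqnn N); rewrite subnn expr0; lra.
  rewrite addnS big_ord_recr /=.
  have -> : index_gap (N + i) N = i by rewrite /index_gap; lia.
  by move: IH; rewrite exprS; move: (_ ^+ i) => y; lra.
have [nN|Nn] := leqP n N.
  apply: le_trans (below n nN) _; apply: (@le_trans _ _ 1); last by lra.
  by rewrite exprn_ile1 //; lra.
have -> : n = (N + (n - N))%N by lia.
by apply: le_trans (above _) _; rewrite gerBl mulr_ge0 ?exprn_ge0.
Qed.

(** With z = N^((1-delta)/4), so that 1/b(N) = z^4, the exponent of the left
    side is at most a constant minus a multiple of z^2, while the logarithm of
    the right side is at least a constant minus a multiple of z. *)
Lemma kappa_small (delta beta omega A : R) :
  delta < 1 -> 0 < beta -> 0 < omega -> 0 < A ->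
  exists N0, forall N, (N0 <= N)%N ->
    2 `^ (1 - Num.sqrt (beta / wv_b delta N * ln (1 / wv_b delta N))) <=
    A * wv_b delta N `^ ((omega - 1) / 2).
Proof.
move=> d1 b0 w0 A0.
pose g := Num.sqrt beta; have g0 : 0 < g by rewrite sqrtr_gt0.
pose ln2 := ln (2 : R); have ln20 : 0 < ln2 by rewrite ln_gt0 //; lra.
pose S := ln2 + `|ln A| + 2 * omega.
have p0 : 0 < (1 - delta) / 4 by rewrite divr_gt0 ?subr_gt0.
have [x1 x11 Hx] := powR_large (Num.max (S / (g * ln2)) (expR 1)) p0.
exists (Num.trunc x1).+1 => N N0.
have xN : x1 <= N%:R.
  by apply: (le_trans (ltW (truncnS_gt x1))); rewrite ler_nat.
have Npos : 0 < N%:R :> R by lra.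
have := Hx _ xN; rewrite ge_max.
pose l := (1 - delta) / 4 * ln (N%:R : R).
have powE (y : R) : N%:R `^ y = expR (y * ln N%:R) by rewrite /powR gt_eqF.
rewrite powE -/l ler_expR => /andP[zS l1].
have bE : wv_b delta N = expR (- (4 * l)).
  by rewrite /wv_b powE /l; congr expR; field.
rewrite bE -expRM div1r -expRN opprK expRK.
have two (x : R) : 2 `^ x = expR (x * ln2) by rewrite /powR gt_eqF.
rewrite two.
rewrite -[A in leRHS](@lnK _ A) ?posrE // -expRD ler_expR.
pose z := expR l; have z0 : 0 < z by exact: expR_gt0.
have lz : l <= z by have := expR_ge1Dx l; rewrite -/z; lra.
have sq : g * z ^+ 2 <= Num.sqrt (beta * expR (4 * l) * (4 * l)).
  have -> : g * z ^+ 2 = Num.sqrt (beta * z ^+ 4).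
    rewrite sqrtrM ?(ltW b0) // -/g; congr (_ * _).
    rewrite (_ : z ^+ 4 = (z ^+ 2) ^+ 2) ?sqrtr_sqr -?exprM //.
    by rewrite ger0_norm ?exprn_ge0 ?(ltW z0).
  rewrite ler_wsqrtr // -mulrA ler_wpM2l ?(ltW b0) //.
  have -> : expR (4 * l) = z ^+ 4 by rewrite -expRM_natl.
  by rewrite ler_peMr ?exprn_ge0 ?(ltW z0) //; lra.
have z1 : 1 <= z by lra.
move: zS; rewrite -/z ler_pdivrMr ?mulr_gt0 // => zS.
have lnA := ler_norm (- ln A); rewrite normrN in lnA.
have h1 : S * z <= z * (g * ln2) * z by rewrite ler_wpM2r ?(ltW z0).
have h2 : omega * l <= omega * z by rewrite ler_wpM2l ?(ltW w0).
have h3 : (ln2 + `|ln A|) * 1 <= (ln2 + `|ln A|) * z.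
  by rewrite ler_wpM2l // addr_ge0 // ltW.
have h4 := ler_wpM2r (ltW ln20) sq.
move: h1 h2 h3 h4; rewrite /S expr2.
have -> : - (4 * l) * ((omega - 1) / 2) = 2 * l - 2 * (omega * l) by field.
move: (Num.sqrt _) => X.
have -> : (1 - X) * ln2 = ln2 - X * ln2 by ring.
have -> : g * (z * z) * ln2 = z * (g * ln2) * z by ring.
have -> : (ln2 + `|ln A| + 2 * omega) * z =
    (ln2 + `|ln A|) * z + 2 * (omega * z) by ring.
have l0 : 0 <= l by lra.
by move: lnA l0; lra.
Qed.

Lemma qnum_ge1 (q : R) N : 0 < q -> q < 1 -> (0 < N)%N -> 1 <= qnum q N.
Proof.
move=> q0 q1 N0; rewrite ler_pdivlMr ?subr_gt0 // mul1r lerD2l lerN2.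
by case: N N0 => // N _; rewrite exprS ger_pMr // exprn_ile1 // ltW.
Qed.

Lemma qnum_ge0 (q : R) k : 0 < q -> q < 1 -> 0 <= qnum q k.
Proof.
move=> q0 q1; rewrite divr_ge0 ?subr_ge0 ?(ltW q1) //.
by rewrite exprn_ile1 ?(ltW q0) ?(ltW q1).
Qed.

Lemma qnum_le (q : R) k : 0 < q -> q < 1 -> qnum q k <= (1 - q)^-1.
Proof.
move=> q0 q1; rewrite ler_pdivrMr ?subr_gt0 // mulVf ?gt_eqF ?subr_gt0 //.
by rewrite gerBl exprn_ge0 // ltW.
Qed.

(** The weight grows by at most a factor q^(-h) per step away from N, up to the
    constant that bounds the quotient of the q-numbers. *)
Lemma weight_le (q h : R) k N : 0 < q -> q < 1 -> 0 <= h -> (0 < N)%N ->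
  q `^ (- (h * k%:R)) * qnum q k `^ h <=
  ((1 - q)^-1) `^ h * (q `^ (- h)) ^+ index_gap k N *
    (q `^ (- (h * N%:R)) * qnum q N `^ h).
Proof.
move=> q0 q1 h0 N0.
have le1 : q `^ (- (h * k%:R)) <=
    (q `^ (- h)) ^+ index_gap k N * q `^ (- (h * N%:R)).
  rewrite -powR_mulrn ?powR_ge0 // -powRrM.
  rewrite -powRD; last by rewrite (gt_eqF q0) implybT.
  apply: ger_powR; first by rewrite q0 ltW.
  rewrite mulNr -opprD lerN2 -mulrDr ler_wpM2l // -natrD ler_nat.
  by rewrite /index_gap; lia.
have le2 : qnum q k `^ h <= ((1 - q)^-1) `^ h * qnum q N `^ h.
  apply: (@le_trans _ _ (((1 - q)^-1) `^ h)).
    by rewrite ge0_ler_powR ?nnegrE ?qnum_ge0 ?qnum_le // invr_ge0 subr_ge0 ltW.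
  rewrite ler_peMr ?powR_ge0 // -[leLHS](powRr0 (qnum q N)).
  by rewrite ler_powR // qnum_ge1.
apply: le_trans (ler_pM (powR_ge0 _ _) (powR_ge0 _ _) le1 le2) _.
by apply: eq_ler; ring.
Qed.

Lemma nneseries_le (P : pred nat) (u : nat -> R) (X : R) :
  (forall k, 0 <= u k) -> (forall n, \sum_(k < n | P k) u k <= X) ->
  (\sum_(k <oo | P k) (u k)%:E <= X%:E)%E.
Proof.
move=> u0 uX; apply: lime_le.
  by apply: is_cvg_nneseries_cond => k _ _; rewrite lee_fin.
apply: nearW => n; rewrite sumEFin lee_fin big_mkord; exact: uX.
Qed.

End FinalSum.

(** * Domination by the maximal term outside the exceptional set *)

Lemma eq_between (i j k : nat) :
  (i <= j)%N -> (j <= k)%N -> i = k -> i = j /\ k = j.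
Proof. lia. Qed.

Section Domination.
Variables (R : realType) (q : R) (a : nat -> R[i]).
Hypotheses (q_gt0 : 0 < q) (q_lt1 : q < 1).
Hypothesis a_infinite : forall n0, exists2 n, (n0 <= n)%N & a n != 0.
Variables (L0 p : R).
Hypotheses (L0_ge1 : 1 <= L0) (p_gt0 : 0 < p) (p_lt1 : p < 1).
Hypothesis term_decay : forall L n, L0 <= L -> L `^ p <= n%:R ->
  aw_term q a (expR L) n <= expR (- (n%:R * L)).

Implicit Types (r : R) (k : nat).

Let t n r := aw_term q a r n.
Let N := aw_central_index q a.
Let G (j : nat) := N (expR j%:R).
Let window := jump_window p.

(** The terms before N: at the smaller radius r1 of equal central index they
    do not exceed the N-th one, and from r1 to r they gain less than it does. *)
Lemma aw_term_low_le r1 r k : 0 < r1 -> r1 <= r -> N r1 = N r ->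
  (k <= N r)%N -> (forall j, (j < N r)%N -> 1 <= r1 * q ^+ j) ->
  t k r <= (2 * r1 / r) ^+ (N r - k) * t (N r) r.
Proof.
move=> r10 r1r NE kN r1q; have r0 : 0 < r by lra.
have [_ max1 _] :=
  aw_central_indexP q_gt0 q_lt1 a_infinite L0_ge1 term_decay r10.
have := max1 k; rewrite -/N NE /t !aw_termE // => le1.
have ratio := @aw_radial_ratio_le _ q q_gt0 q_lt1 r1 r (2 * r1 / r) k (N r)
  (ltW r10) (ltW r0) kN.
have {}ratio := ratio (fun j Hj => aw_factor_ratio_le q_gt0 q_lt1 r10 r0
  (r1q j ltac:(by case/andP: Hj))).
have P1 := aw_radial_gt0 q_gt0 k (ltW r10).
have P2 := aw_radial_gt0 q_gt0 k (ltW r0).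
rewrite -(ler_pM2r P1).
apply: (@le_trans _ _
  (cmod (a (N r)) * aw_radial q (N r) r1 * aw_radial q k r)).
  by rewrite mulrAC ler_wpM2r // ltW.
rewrite -mulrA; apply: le_trans (ler_wpM2l (cmod_ge0 _) ratio) _.
apply: eq_ler; move: (_ ^+ _) (cmod _) (aw_radial _ _ _) (aw_radial _ _ _).
by move=> x y z w; ring.
Qed.

(** The terms after N: at the larger radius r2 of equal central index they still
    do not exceed the N-th one, and going back to r they lose more than it. *)
Lemma aw_term_high_le r r2 k : 0 < r -> r <= r2 -> N r2 = N r ->
  (N r <= k)%N -> (forall j, (j < k)%N -> 1 <= r * q ^+ j) ->
  t k r <= (2 * r / r2) ^+ (k - N r) * t (N r) r.
Proof.
move=> r0 rr2 NE Nk rq; have r20 : 0 < r2 by lra.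
have [_ max2 _] :=
  aw_central_indexP q_gt0 q_lt1 a_infinite L0_ge1 term_decay r20.
have := max2 k; rewrite -/N NE /t !aw_termE // => le1.
have ratio := @aw_radial_ratio_le _ q q_gt0 q_lt1 r r2 (2 * r / r2) (N r) k
  (ltW r0) (ltW r20) Nk.
have {}ratio := ratio (fun j Hj => aw_factor_ratio_le q_gt0 q_lt1 r0 r20
  (rq j ltac:(by case/andP: Hj))).
have P2 := aw_radial_gt0 q_gt0 (N r) (ltW r20).
have P1 := aw_radial_gt0 q_gt0 (N r) (ltW r0).
have c0 : 0 <= (2 * r / r2) ^+ (k - N r).
  by rewrite exprn_ge0 // divr_ge0 ?mulr_ge0 // ltW.
rewrite -(ler_pM2r P2) -[leLHS]mulrA.
apply: le_trans (ler_wpM2l (cmod_ge0 _) ratio) _.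
have := ler_wpM2l (mulr_ge0 c0 (ltW P1)) le1.
move: (_ ^+ _) (cmod _) (cmod _) (aw_radial _ _ _) (aw_radial _ _ _).
move: (aw_radial _ _ _) => x1 x2 x3 x4 x5 x6 le2.
apply: le_trans (le_trans _ le2) _; apply: eq_ler; ring.
Qed.

Lemma jump_set_density_zero :
  [/\ measurable (jump_set G p), jump_set G p `<=` `[1, +oo[ &
      log_density (jump_set G p) = 0%E].
Proof.
have [L1 L01 HL1] :=
  aw_central_index_lt_powR q_gt0 q_lt1 a_infinite L0_ge1 p_gt0 term_decay.
have Ghomo i j : (i <= j)%N -> (G i <= G j)%N.
  move=> ij.
  apply: (le_aw_central_index q_gt0 q_lt1 a_infinite L0_ge1 term_decay).
    exact: expR_gt0.
  by rewrite ler_expR ler_nat.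
split; first exact: measurable_jump_set.
  by move=> x [x1 _] /=; rewrite in_itv /= x1.
apply: (@log_density_jump_set _ G p (Num.trunc L1).+1) => // j j1.
rewrite ltW //; apply: HL1; apply: (le_trans (ltW (truncnS_gt L1))).
by rewrite ler_nat.
Qed.

Lemma aw_term_near_le (r rl ru e K : R) k :
  0 < e -> 0 < rl -> rl <= r -> r <= ru ->
  N rl = N r -> N ru = N r -> 2 * rl <= e * r -> 2 * r <= e * ru ->
  (N r)%:R <= K -> (forall j, j%:R <= K -> 1 <= rl * q ^+ j) -> k%:R <= K ->
  t k r <= e ^+ index_gap k (N r) * t (N r) r.
Proof.
move=> e0 rl0 rlr rru Nl Nu el eu NK small kK.
have r0 : 0 < r by lra.
have ru0 : 0 < ru by lra.
have tN0 : 0 <= t (N r) r by apply: aw_term_ge0 => //; rewrite ltW.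
have [kN|/ltnW Nk] := leqP k (N r).
  rewrite index_gap_low //.
  apply: le_trans (aw_term_low_le rl0 rlr Nl kN _) _ => [j jN|].
    by apply: small; apply: le_trans NK; rewrite ler_nat ltnW.
  rewrite ler_wpM2r // lerXn2r ?nnegrE ?(ltW e0) ?ler_pdivrMr //.
  by rewrite divr_ge0 ?mulr_ge0 // ltW.
rewrite index_gap_high //.
apply: le_trans (aw_term_high_le r0 rru Nu Nk _) _ => [j jk|].
  apply: (@le_trans _ _ (rl * q ^+ j)).
    by apply: small; apply: le_trans kK; rewrite ler_nat ltnW.
  by rewrite ler_wpM2r ?exprn_ge0 // ltW.
rewrite ler_wpM2r // lerXn2r ?nnegrE ?(ltW e0) ?ler_pdivrMr //.
by rewrite divr_ge0 ?mulr_ge0 // ltW.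
Qed.

(** Away from the jumps the maximal term dominates geometrically with an
    arbitrarily small ratio. Near N this is the comparison with the ends of the
    window, where the central index is the same; beyond (ln r)^p the absolute
    decay of the terms takes over. *)
Lemma aw_term_geometric (e : R) : 0 < e -> e < 1 ->
  exists2 R0 : R, 1 <= R0 & forall r, R0 < r -> ~ jump_set G p r ->
    forall k, t k r <= e ^+ index_gap k (N r) * t (N r) r.
Proof.
move=> e0 e1.
have [eta eta0 Heta] :=
  aw_max_term_lower q_gt0 q_lt1 a_infinite L0_ge1 term_decay.
have [L1 L01 HL1] :=
  aw_central_index_lt_powR q_gt0 q_lt1 a_infinite L0_ge1 p_gt0 term_decay.
have c0 : 0 < - ln q by rewrite oppr_gt0 ln_lt0 // q_gt0.
have [X X1 HX] := jump_window_large (- ln (e / 2)) p_gt0 p_lt1 c0.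
pose L2 := Num.max X (Num.max L1 (`|ln eta| - ln e)).
have [L2X L2L1 L2e] : [/\ X <= L2, L1 <= L2 & `|ln eta| - ln e <= L2].
  by rewrite /L2 !le_max !lexx !orbT.
clearbody L2; exists (expR L2); first by rewrite -[leLHS]expR0 ler_expR; lra.
move=> r rL2 notE k.
have r0 : 0 < r by apply: lt_trans rL2; exact: expR_gt0.
have [L lnr] : exists L, ln r = L by exists (ln r).
have rL : r = expR L by rewrite -lnr lnK.
have LL2 : L2 < L by rewrite -ltr_expR -rL.
have r1 : 1 <= r by rewrite rL -[leLHS]expR0 ler_expR; lra.
have L_0 : 0 <= L by lra.
have [vm vbig Lp] := HX L ltac:(lra).
have /andP[mL Lm] := truncn_itv L_0.
have : G (Num.trunc L - window (Num.trunc L)) =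
       G (Num.trunc L + (window (Num.trunc L)).+1).
  apply/eqP; apply: contra_notT notE => jm; rewrite /jump_set /= lnr.
  by split.
clear notE; rewrite -/(window _) in vm vbig Lp.
move: (Num.trunc L) mL Lm vm vbig Lp => m mL Lm.
move: (window m) => v vm vbig Lp.
have homo r' r'' : 0 < r' -> r' <= r'' -> (N r' <= N r'')%N.
  exact: (le_aw_central_index q_gt0 q_lt1 a_infinite L0_ge1 term_decay).
have [rl rlE] : exists x : R, x = expR (m - v)%:R by eexists.
have [ru ruE] : exists x : R, x = expR (m + v.+1)%:R by eexists.
have rlr : rl <= r.
  by rewrite rlE rL ler_expR (le_trans _ mL) // ler_nat leq_subr.
have rru : r <= ru.
  rewrite ruE rL ler_expR (le_trans (ltW Lm)) //.
  by rewrite ler_nat addnS ltnS leq_addr.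
have rl0 : 0 < rl by rewrite rlE expR_gt0.
have half : 2 * expR (- v%:R) <= e.
  have : expR (- v%:R) <= e / 2.
    by rewrite -[leRHS](@lnK _ (e / 2)) ?posrE ?divr_gt0 // ler_expR; lra.
  by lra.
have rl_small : 2 * rl <= e * r.
  apply: (@le_trans _ _ (2 * expR (- v%:R) * r)); last first.
    by rewrite ler_wpM2r // ltW.
  rewrite -mulrA ler_wpM2l // rlE rL -expRD ler_expR natrB //.
  by rewrite addrC lerD2l.
have ru_large : 2 * r <= e * ru.
  apply: (@le_trans _ _ (2 * expR (- v%:R) * ru)); last first.
    by rewrite ler_wpM2r // ruE expR_ge0.
  rewrite -mulrA ler_wpM2l // ruE rL -expRD ler_expR natrD -natr1.
  by move: Lm; rewrite -natr1; lra.
have NL : (N r)%:R <= L `^ p by rewrite ltW // rL; apply: HL1; lra.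
(* In this range of indices the factors are proportional to the radius. *)
have monomial j : j%:R <= L `^ p -> 1 <= rl * q ^+ j.
  move=> jL; have -> : q ^+ j = expR (- (- ln q * j%:R)).
    by rewrite expRN -qV_expR // invrK.
  rewrite rlE -expRD -[leLHS]expR0 ler_expR subr_ge0; apply: le_trans Lp.
  by rewrite ler_wpM2l // ltW.
rewrite /G -rlE -ruE.
move=> /(eq_between (homo _ _ rl0 rlr) (homo _ _ r0 rru))[Nl Nu].
have [kL|Lk] := leP k%:R (L `^ p).
  exact: (aw_term_near_le e0 rl0 rlr rru Nl Nu rl_small ru_large NL
    monomial kL).
clear Nl Nu.
have LL0 : L0 <= L by lra.
have := term_decay LL0 (ltW Lk); rewrite -rL => /le_trans; apply.
have k0 : (0 < k)%N.
  by rewrite -(ltr_nat R); apply: le_lt_trans Lk; exact: powR_ge0.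
have k1 : 1 <= k%:R :> R by rewrite ler1n.
apply: (@le_trans _ _ (e ^+ k * eta)); last first.
  apply: ler_pM; rewrite ?exprn_ge0 ?(ltW e0) ?(ltW eta0) //; last exact: Heta.
  have Nk : (N r <= k)%N.
    by rewrite -(ler_nat R); apply: le_trans NL (ltW Lk).
  by rewrite index_gap_high // ler_wiXn2l ?(ltW e0) ?(ltW e1) // leq_subr.
have -> : e ^+ k * eta = expR (k%:R * ln e + ln eta).
  by rewrite expRD expRM_natl !lnK ?posrE.
rewrite ler_expR; have lne0 : ln e < 0 by rewrite ln_lt0 // e0.
have le1 : 0 <= (k%:R - 1) * (L + ln e).
  by rewrite mulr_ge0 ?subr_ge0 //; have := normr_ge0 (ln eta); lra.
have := ler_norm (- ln eta); rewrite normrN.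
by move: le1; rewrite mulrBl mul1r mulrDr; lra.
Qed.

End Domination.

Lemma aw_coef_infinite (R : realType) (q : R) (f : R[i] -> R[i])
    (a : nat -> R[i]) :
  transcendental_entire f -> aw_expansion q a f ->
  forall n0, exists2 n, (n0 <= n)%N & a n != 0.
Proof.
move=> [_ notpoly] ha n0; apply: contrapT => noex; apply: notpoly.
have a0 n : (n0 <= n)%N -> a n = 0.
  by move=> n0n; apply/eqP; apply: contra_notT noex => an; exists n.
exists (aw_nest q a n0 0) => z; rewrite aw_nest_sum.
apply/eqP; rewrite -subr_eq0 -cmod_eq0 eq_le cmod_ge0 andbT.
apply/ler_addgt0Pr => e e0; rewrite add0r.
have [m0 Hm0] := aw_expansion_circle (cmod z) ha e0.
have := Hm0 (maxn m0 n0) (leq_maxl _ _) z erefl.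
have -> : \sum_(k < maxn m0 n0) a k * aw_phi q k z =
    \sum_(k < n0) a k * aw_phi q k z.
  have -> : maxn m0 n0 = (n0 + (maxn m0 n0 - n0))%N by lia.
  rewrite big_split_ord /= [X in _ + X]big1 ?addr0 // => k _.
  by rewrite a0 ?mul0r //= leq_addr.
exact: ltW.
Qed.

(** * The tail of the series *)

Theorem theorem3p2 (R : realType) (q : R) (hq0 : 0 < q) (hq1 : q < 1)
    (f : R[i] -> R[i]) (a : nat -> R[i])
    (hf : transcendental_entire f)
    (hsigma : (log_order f < 2%:E)%E)
    (ha : aw_expansion q a f)
    (gamma : R) (hgamma1 : 1 < gamma)
    (hgamma2 : (gamma%:E < (log_order f - 1%:E)^-1)%E)
    (delta : R) (hdelta0 : 0 < delta) (hdelta1 : delta < 1) :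
  exists E : set R,
    [/\ measurable E, E `<=` `[1, +oo[, log_density E = 0%E &
      forall h beta omega : R, 0 <= h -> 0 < beta ->
        0 < omega -> omega < beta ->
        little_o_outside E
          (fun r => let N := aw_central_index q a r in
             aw_tail_sum q a h r N (wv_kappa delta beta N))
          (fun r => let N := aw_central_index q a r in
             aw_max_term q a r * q `^ (- (h * N%:R)) * qnum q N `^ h
               * wv_b delta N `^ ((omega - 1) / 2))].
Proof.
pose s := gamma^-1.
have gamma0 : 0 < gamma by lra.
have s0 : 0 < s by rewrite invr_gt0.
have s1 : s < 1 by rewrite invf_lt1.
(* The hypotheses on gamma rule out the values of log_order for which the
   extended-real inverse is negative, so 1 / gamma bounds log_order - 1. *)
have hlog : (log_order f < (1 + s)%:E)%E.
  case: (log_order f) hsigma hgamma2 => [sg _| |_ _]; last by rewrite ltNyr.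
    rewrite -EFinB inver lte_fin; case: eqP => [sg1 _|_]; first by lra.
    rewrite lte_fin => hg; have sg0 : 0 < sg - 1.
      by rewrite -invr_gt0 (lt_trans gamma0).
    by rewrite -ltrBlDl /s -[sg - 1]invrK ltf_pV2 ?posrE ?invr_gt0.
  by rewrite ltNge leey.
(* Any exponent strictly between s and 1 would do. *)
pose p := (1 + s) / 2.
have [sp p1] : s < p /\ p < 1 by rewrite /p; split; lra.
have p0 : 0 < p by lra.
have [L0 L01 decay] := aw_term_decay hq0 hq1 ha s0 sp p1 hlog.
have ainf := aw_coef_infinite hf ha.
have [mE subE densE] := jump_set_density_zero hq0 hq1 ainf L01 p0 p1 decay.
exists (jump_set (fun j => aw_central_index q a (expR j%:R)) p); split=> //.
move=> h beta omega h0 b0 w0 _ C C0.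
(* Of the 4, one 2 makes the sum over all k converge and the other one yields
   the factor 2^(-kappa). *)
pose e := q `^ h / 4.
have qh0 : 0 < q `^ h by exact: powR_gt0.
have e0 : 0 < e by rewrite divr_gt0.
have e1 : e < 1.
  have : q `^ h <= q `^ 0 by apply: ger_powR h0; rewrite hq0 ltW.
  by rewrite powRr0 /e; lra.
have [R1 R11 HR1] := aw_term_geometric hq0 hq1 ainf L01 p0 p1 decay e0 e1.
pose D := ((1 - q)^-1) `^ h.
have D0 : 0 < D by rewrite powR_gt0 // invr_gt0 subr_gt0.
have CD : 0 < C / (3 * D) by rewrite divr_gt0 // mulr_gt0.
have [N0 HN0] := kappa_small hdelta1 b0 w0 CD.
have [R2 R21 HR2] :=
  aw_central_index_unbounded hq0 hq1 ainf L01 decay (maxn 1 N0).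
exists (Num.max R1 R2); first by rewrite lt_max; apply/orP; left; lra.
move=> r; rewrite gt_max => /andP[rR1 rR2] notE /=.
have r0 : 0 < r by lra.
have [maxE _ _] := aw_central_indexP hq0 hq1 ainf L01 decay r0.
have geom := HR1 r rR1 notE.
have := HR2 r (ltW rR2); rewrite geq_max => /andP[].
rewrite maxE; move: (aw_central_index q a r) geom => N geom N1 NN0.
set W := q `^ (- (h * N%:R)) * qnum q N `^ h.
have W0 : 0 <= W by rewrite mulr_ge0 ?powR_ge0.
have t0 n : 0 <= aw_term q a r n by apply: aw_term_ge0 => //; exact: ltW.
rewrite -[_ * _ * qnum q N `^ h]mulrA -/W.
set B := wv_b delta N `^ _; have B0 : 0 <= B := powR_ge0 _ _.
rewrite ger0_norm; last exact: mulr_ge0 (mulr_ge0 (t0 N) W0) B0.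
have u0 k : 0 <= q `^ (- (h * k%:R)) * qnum q k `^ h *
    cmod (a k * aw_phi q k (- r%:C)).
  by rewrite !mulr_ge0 ?powR_ge0 ?cmod_ge0.
rewrite gee0_abs; last by apply: nneseries_ge0 => k _ _; rewrite lee_fin.
pose x := Num.sqrt (beta / wv_b delta N * ln (1 / wv_b delta N)).
have tau : 2 `^ (1 - x) <= C / (3 * D) * B by exact: HN0.
have term_le k : (wv_kappa delta beta N <= `|k%:Z - N%:Z|)%R ->
    q `^ (- (h * k%:R)) * qnum q k `^ h * cmod (a k * aw_phi q k (- r%:C)) <=
    D * 2 `^ (1 - x) * (W * aw_term q a r N) * 2^-1 ^+ index_gap k N.
  move=> kk; rewrite cmodM cmod_aw_phi_neg ?(ltW r0) // -aw_termE //.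
  apply: le_trans (ler_pM _ _ (weight_le k hq0 hq1 h0 N1) (geom k)) _ => //.
    by rewrite mulr_ge0 ?powR_ge0.
  rewrite -/W -/D; set d := index_gap k N.
  have -> : D * (q `^ (- h)) ^+ d * W * (e ^+ d * aw_term q a r N) =
      (D * (W * aw_term q a r N)) * ((q `^ (- h)) ^+ d * e ^+ d) by ring.
  have -> : (q `^ (- h)) ^+ d * e ^+ d = 2^-1 ^+ d * 2^-1 ^+ d.
    rewrite -!exprMn; congr (_ ^+ d); rewrite /e powRN.
    by field; rewrite gt_eqF.
  have half_le : 2^-1 ^+ d <= 2 `^ (1 - x).
    have -> : 2^-1 ^+ d = 2 `^ (- d%:R) :> R by rewrite powR_invn // exprVn.
    rewrite ler_powR //; first by lra.
    have : x < (wv_kappa delta beta N + 1)%:~R by exact: floorD1_gt.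
    have : (wv_kappa delta beta N)%:~R <= d%:R :> R.
      rewrite -[d%:R]/(d%:Z%:~R) ler_int.
      by rewrite norm_subz_index_gap in kk.
    by rewrite intrD; lra.
  have DW := mulr_ge0 (ltW D0) (mulr_ge0 W0 (t0 N)).
  have -> : D * 2 `^ (1 - x) * (W * aw_term q a r N) * 2^-1 ^+ d =
      D * (W * aw_term q a r N) * (2 `^ (1 - x) * 2^-1 ^+ d) by ring.
  by rewrite ler_wpM2l // ler_wpM2r // exprn_ge0.
apply: nneseries_le => // n.
have K0 := mulr_ge0 (mulr_ge0 (ltW D0) (powR_ge0 2 (1 - x)))
  (mulr_ge0 W0 (t0 N)).
apply: (@le_trans _ _ (\sum_(k < n) D * 2 `^ (1 - x) * (W * aw_term q a r N) *
    2^-1 ^+ index_gap k N)).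
  rewrite big_mkcond /=; apply: ler_sum => k _; case: ifP => [|_].
    exact: term_le.
  by rewrite mulr_ge0 // exprn_ge0.
rewrite -mulr_sumr.
apply: le_trans (ler_wpM2l K0 (sum_half_index_gap_le R N n)) _.
have D30 : 0 <= 3 * D by rewrite mulr_ge0 // ltW.
have le1 := ler_wpM2l (mulr_ge0 D30 (mulr_ge0 W0 (t0 N))) tau.
have -> : D * 2 `^ (1 - x) * (W * aw_term q a r N) * 3 =
  3 * D * (W * aw_term q a r N) * 2 `^ (1 - x) by ring.
apply: le_trans le1 _; apply: eq_ler.
by field; rewrite gt_eqF.
Qed.
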